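(* Let $k,m,a\geq 1$ and $b$ be integers. Suppose that $p(an+b)\equiv 0 \pmod k$ for all non-negative integers $n$. Then for all integers $t\geq 1$, \[ p_{mat,at}(an+b)\equiv 0 \pmod k \] for all non-negative integers $n$.
   Context: $p(n)$ denotes the number of partitions of $n$ (non-increasing sequences of positive integers summing to $n$), with $p(0)=1$ and the convention $p(n)=0$ for negative integers $n$. For positive integers $A$ and $c$, and a partition $\lambda$, $\mathrm{mex}_{A,c}(\lambda)$ is the smallest positive integer congruent to $c$ modulo $A$ that is not a part of $\lambda$; $p_{A,c}(n)$ is the number of partitions $\lambda$ of $n$ with $\mathrm{mex}_{A,c}(\lambda)\equiv c\pmod{2A}$, and $p_{A,c}(n)=0$ for negative $n$. *)

(* Defs.v *)
From mathcomp Require Import all_boot all_order all_algebra.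
Set Implicit Arguments. Unset Strict Implicit. Unset Printing Implicit Defensive.
Import GRing.Theory Num.Theory.

Definition is_partn (n : nat) (s : seq nat) : bool :=
  [&& sorted geq s, all (fun x => 0 < x) s & sumn s == n].

Fixpoint seqs_of_len (n k : nat) : seq (seq nat) :=
  if k is k'.+1 then [seq x :: s | x <- iota 0 n.+1, s <- seqs_of_len n k']
  else [:: [::]].

(* All sequences of length <= n with entries <= n; every partition of n
   appears among them. *)
Definition partn_cands (n : nat) : seq (seq nat) :=
  flatten [seq seqs_of_len n k | k <- iota 0 n.+1].

Definition partns (n : nat) : seq (seq nat) :=
  undup [seq s <- partn_cands n | is_partn n s].

Definition npart (n : nat) : nat := size (partns n).

Definition npartz (x : int) : nat :=
  match x with Posz n => npart n | Negz _ => 0 end.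

(* mex_{A,c}(s): the smallest positive integer congruent to c mod A that
   is not a part of s (for A, c >= 1).  The smallest positive integer
   congruent to c mod A is c0 = ((c-1) mod A) + 1; the candidates are
   c0 + A*j, and among j = 0..size s one is not a part. *)
Definition mex (A c : nat) (s : seq nat) : nat :=
  let c0 := (c.-1 %% A).+1 in
  c0 + A * find (fun j => c0 + A * j \notin s) (iota 0 (size s).+1).

Definition pmex (A c n : nat) : nat :=
  count (fun s => mex A c s == c %[mod 2 * A]) (partns n).

Definition pmexz (A c : nat) (x : int) : nat :=
  match x with Posz n => pmex A c n | Negz _ => 0 end.

(* Main.v *)
Require Import Defs.
From mathcomp Require Import all_boot all_order all_algebra.
From mathcomp Require Import finfield generic_quotient boolp.
From mathcomp Require Import zify ring lra.
From HB Require Import structures.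
Import Order.TTheory GRing.Theory Num.Theory.
Set Implicit Arguments. Unset Strict Implicit. Unset Printing Implicit Defensive.

(** The crucial point is that the congruence propagates backwards: if [k] divides [p(an+b)] for all
    [n >= 0], it divides [p(an+b)] for every integer [n]; then the alternating sum
    [p_{A,c}(N) = sum_i (-1)^i p(N - (i c + A i (i - 1) / 2))], whose shifts are multiples of [a],
    gives the theorem.  If the propagation fails, there are a prime power [q = l ^ e], a modulus [A > n0] and a value [p(n0)]
    not divisible by [q] while [q] divides [p(n)] for all other [n = n0 mod A].

    Put [eta = sum_{n = 1 mod 6} (-1)^((n-1)/6) x^(n^2)], so that [eta * sum p(n) x^(24 n) = x] by Euler.
    Inverting a circulant matrix writes the part of [sum p(n) x^(24 n)] with [n = n0 mod A] as a
    quotient of homogeneous polynomials in the series [T_c = sum_{n = c mod 2 mu} x^(n^2)].  With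
    [U_c = T_{c + mu}] the addition formulas give [T_c^4 + U_c^4 = T_0^3 T_{2c} + U_0^3 U_{2c}] and
    [2 T_c^2 U_c^2 = T_0 U_0 (T_0 U_{2c} + U_0 T_{2c})], so [T_c^8] has lower degree over
    [Q[T_0, U_0]] and the forms of degree [K] in the [T_c] span a space of dimension [O(K)].
    Counting monomials yields an algebraic relation between the section of the partition series, [eta] and
    [eta(x^(l^2))].  Made primitive and reduced modulo [l], where the section becomes
    a monomial and [eta(x^(l^2)) = eta^(l^2)], it is a nontrivial polynomial relation between
    [x] and [eta] over [F_l].  But [eta] is transcendental over [F_l(x)]: a relation would give one of the form
    [sum_i a_i(x) eta(x^(l^i)) = 0], forcing [n^2] to be within bounded distance of some
    [l k^2] for all large [n = 1 mod 12 l], and two such [n] at bounded distance are incompatible. *)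

(** * Partitions and the minimal excludant *)

Section Partitions.
Implicit Types (n k x : nat) (s L : seq nat).

Lemma mem_seqs_of_len n s : all (fun x => x <= n) s ->
  s \in seqs_of_len n (size s).
Proof.
elim: s => // x s IH /andP[xn /IH hs].
by apply: (@allpairs_f _ _ _ (fun y u => y :: u)) => //; rewrite mem_iota.
Qed.

Lemma geq_trans : transitive geq. Proof. by move=> y x z /= h1 h2; apply: leq_trans h1. Qed.
Lemma geq_total : total geq. Proof. by move=> x y /=; case: leqP => // /ltnW ->; rewrite orbT. Qed.
Lemma geq_anti : antisymmetric geq.
Proof. by move=> x y /=; rewrite andbC -eqn_leq => /eqP. Qed.

Lemma leq_sumn_mem x s : x \in s -> x <= sumn s.
Proof.
elim: s => //= y s IH; rewrite inE => /orP[/eqP->|/IH h]; first exact: leq_addr.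
exact: leq_trans h (leq_addl _ _).
Qed.

Lemma size_partn n s : is_partn n s -> size s <= n.
Proof.
case/and3P=> _ hp /eqP <-; elim: s hp => //= x s IH /andP[x0 /IH h].
by rewrite -add1n leq_add.
Qed.

Lemma mem_partns n s : (s \in partns n) = is_partn n s.
Proof.
rewrite mem_undup mem_filter; case h: (is_partn n s) => //=.
apply/flattenP; exists (seqs_of_len n (size s)).
  by apply/map_f; rewrite mem_iota ltnS (size_partn h).
apply: mem_seqs_of_len; apply/allP => x xs.
by case/and3P: h => _ _ /eqP <-; apply: leq_sumn_mem.
Qed.

Lemma is_partn_perm n s t : perm_eq s t -> sorted geq t ->
  is_partn n s -> is_partn n t.
Proof.
move=> st hs /and3P[_ hp hn].
by rewrite /is_partn hs -(perm_all _ st) hp -(perm_sumn st).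
Qed.

Lemma is_partn_cons n x s : 0 < x ->
  is_partn (x + n) (sort geq (x :: s)) = is_partn n (sort geq s).
Proof.
move=> x0; rewrite /is_partn !(sort_sorted geq_total) /=.
rewrite !all_sort /= x0 /=; congr (_ && _).
have -> : sumn (sort geq (x :: s)) = sumn (x :: s) by apply/perm_sumn/permPl/perm_sort.
have -> : sumn (sort geq s) = sumn s by apply/perm_sumn/permPl/perm_sort.
by rewrite /= eqn_add2l.
Qed.

(** [rem x] and insertion of [x] followed by sorting are mutually inverse between the partitions of
    [n] having [x] as a part and the partitions of [n - x]; the two hypotheses let them exchange [P]
    and [P']. *)
Lemma count_partns_rem n x (P P' : pred (seq nat)) : 0 < x ->
  (forall s, P' s -> P (sort geq (x :: s))) ->
  (forall s, x \in s -> P s -> P' (rem x s)) ->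
  count (fun s => (x \in s) && P s) (partns n) =
  if x <= n then count P' (partns (n - x)) else 0.
Proof.
move=> x0 hP hP'; case: leqP => [xn|nx]; last first.
  apply/eqP; rewrite -leqn0 -ltnS ltnS -(count_pred0 (partns n)).
  rewrite (eq_in_count (a2 := pred0)) // => s; rewrite mem_partns.
  case/and3P => _ _ /eqP hn; case xs: (x \in s) => //=.
  by move: nx; rewrite ltnNge -hn leq_sumn_mem.
rewrite -!size_filter -[RHS](size_map (fun s => sort geq (x :: s))).
apply/perm_size/uniq_perm.
- by rewrite filter_uniq ?undup_uniq.
- rewrite map_inj_in_uniq ?filter_uniq ?undup_uniq // => s t.
  rewrite !mem_filter !mem_partns => /andP[_ /and3P[hs _ _]] /andP[_ /and3P[ht _ _]] e.
  have: perm_eq (x :: s) (x :: t).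
    by rewrite -(perm_sort geq) -[X in perm_eq X _]/(sort geq (x :: s)) e perm_sort.
  by rewrite perm_cons; apply: (sorted_eq geq_trans geq_anti).
move=> s; rewrite mem_filter mem_partns; apply/idP/mapP.
  case/andP => /andP[xs Ps] hs; exists (rem x s).
    rewrite mem_filter hP' // mem_partns.
    have hr : sorted geq (rem x s).
      by apply: (subseq_sorted geq_trans (rem_subseq _ _)); case/and3P: hs.
    have := @is_partn_cons (n - x) x (rem x s) x0.
    rewrite (sorted_sort geq_trans hr) => <-; rewrite subnKC //.
    apply: (is_partn_perm _ (sort_sorted geq_total _) hs).
    by rewrite perm_sym perm_sort perm_sym perm_to_rem.
  apply: (sorted_eq geq_trans geq_anti).
  - by case/and3P: hs.
  - exact: sort_sorted geq_total _.
  - by rewrite perm_sym perm_sort perm_sym perm_to_rem.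
case=> t; rewrite mem_filter mem_partns => /andP[Pt ht] ->.
rewrite hP // mem_sort inE eqxx /= -(subnKC xn) is_partn_cons //.
by rewrite (sorted_sort geq_trans) //; case/and3P: ht.
Qed.

Definition npart_le k n := count (all (fun x => x <= k)) (partns n).

Lemma npart_le0 n : npart_le 0 n = (n == 0).
Proof.
case: n => [|n] /=; first by [].
rewrite /npart_le (eq_in_count (a2 := pred0)) ?count_pred0 // => s.
rewrite mem_partns; case/and3P; case: s => //= x s _ /andP[x0 _] _.
by rewrite leqNgt x0.
Qed.

(** Either [k.+1] is not a part, or one copy of it can be removed. On generating functions this is
    the factor 1 / (1 - y^(k+1)). *)
Lemma npart_leS k n :
  npart_le k.+1 n = npart_le k n + (if k < n then npart_le k.+1 (n - k.+1) else 0).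
Proof.
rewrite /npart_le -(@count_partns_rem n k.+1 (all (fun x => x <= k.+1))) //.
- rewrite -count_predUI addnC.
  rewrite (eq_in_count (a1 := predI _ _) (a2 := pred0)) ?count_pred0; last first.
    move=> s _ /=; apply/negbTE/negP => /andP[/allP h] /andP[/h].
    by rewrite ltnn.
  apply: eq_count => s /=; apply/idP/orP; last first.
    case=> [|/andP[]//]; apply: sub_all => x h; exact: leq_trans h (leqnSn _).
  move=> h; case ks: (k.+1 \in s); [by right | left].
  apply/allP => x xs; move/allP: h => /(_ x xs).
  by rewrite leq_eqVlt ltnS => /orP[/eqP e|//]; rewrite -e xs in ks.
- by move=> s h; rewrite all_sort /= leqnn.
by move=> s _ /allP h; apply/allP => x /mem_rem /h.
Qed.

Lemma npart_leE k n : n <= k -> npart_le k n = npart n.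
Proof.
move=> nk; rewrite /npart_le (eq_in_count (a2 := predT)) ?count_predT // => s.
rewrite mem_partns => /and3P[_ _ /eqP hn]; apply/allP => x /leq_sumn_mem.
by rewrite hn => h; apply: leq_trans nk.
Qed.

(** The members of [L] are removed one at a time; as [L] has no repetition, removing one leaves the
    others in place. *)
Lemma count_partns_sub L n : uniq L -> all (fun x => 0 < x) L ->
  count (fun s => all (mem s) L) (partns n) =
  if sumn L <= n then npart (n - sumn L) else 0.
Proof.
elim: L n => [|x L IH] n /=; first by rewrite subn0 count_predT.
case/andP=> xL uL /andP[x0 hL].
rewrite (@count_partns_rem n x _ (fun s => all (mem s) L)) //.
- case: leqP => xn; last by rewrite leqNgt (leq_trans xn (leq_addr _ _)).
  by rewrite IH // leq_subRL // subnDA.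
- move=> s /allP h; apply/allP => y yL; rewrite /= mem_sort inE.
  by rewrite [y \in s]h ?orbT.
move=> s xs /allP h; apply/allP => y yL.
have := h y yL; rewrite /= (perm_mem (perm_to_rem xs)) inE => /orP[/eqP e|//].
by rewrite -e yL in xL.
Qed.

Definition mex_terms A c i := [seq c + A * j | j <- iota 0 i].

Lemma uniq_mex_terms A c i : 0 < A -> uniq (mex_terms A c i).
Proof.
move=> A0; rewrite map_inj_uniq ?iota_uniq // => a b /eqP.
by rewrite eqn_add2l eqn_pmul2l // => /eqP.
Qed.

(** If [J] is the first index with [c + A * J] not a part, the first [i] terms are all parts exactly
    when [i <= J]. The sum is then 1 - 1 + 1 - ... with [J + 1] terms, which is 1 for even [J] and 0
    for odd [J]. *)
Lemma mex_signs A c n s : 0 < c -> c <= A -> is_partn n s ->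
  (Posz (mex A c s == c %[mod 2 * A]) =
   \sum_(i < n.+2) (-1) ^+ i * Posz (all (mem s) (mex_terms A c i)))%R.
Proof.
move=> c0 cA hs; have A0 : 0 < A := leq_trans c0 cA.
have ec : (c.-1 %% A).+1 = c by rewrite modn_small ?prednK.
rewrite /mex ec; set p := fun j => _; set J := find _ _.
have hp : has p (iota 0 (size s).+1).
  apply/negPn/negP => /hasPn h.
  (* Pigeonhole: [size s + 1] distinct terms cannot all be among the parts. *)
  have := @uniq_leq_size _ (mex_terms A c (size s).+1) s (uniq_mex_terms _ _ A0).
  rewrite size_map size_iota ltnn => H; apply: notF; apply: H => y /mapP[j hj ->].
  by have := h j hj; rewrite /p negbK.
have hJ : J < (size s).+1 by rewrite /J -[X in _ < X](size_iota 0) -has_find.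
have Jn : J <= n by apply: leq_trans (size_partn hs); rewrite -ltnS.
have pJ : p J by have := nth_find 0 hp; rewrite -/J nth_iota.
have pj j : j < J -> c + A * j \in s.
  move=> jJ; have := before_find 0 jJ.
  by rewrite nth_iota ?add0n ?(ltn_trans jJ) // /p => /negbFE.
have hall i : all (mem s) (mex_terms A c i) = (i <= J).
  case: leqP => h.
    apply/allP => y /mapP[j]; rewrite mem_iota add0n => /andP[_ ji] ->.
    by apply: pj; apply: leq_trans h.
  apply/negbTE/allPn; exists (c + A * J) => //.
  by apply/mapP; exists J => //; rewrite mem_iota.
under eq_bigr => i _ do rewrite hall.
have -> : (c + A * J == c %[mod 2 * A]) = ~~ odd J.
  rewrite -[X in _ == X %[mod _]]addn0 eqn_modDl mod0n [A * J]mulnC.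
  by rewrite -/(dvdn _ _) dvdn_pmul2r // dvdn2.
have : J < n.+2 by rewrite ltnS (leq_trans Jn).
elim: (n.+2) => // N IH; rewrite ltnS leq_eqVlt big_ord_recr /= => /orP[/eqP JN|JN].
  rewrite JN leqnn mulr1; clear -JN.
  have -> : (\sum_(i < N) (-1) ^+ i * Posz (i <= N) = Posz (odd N))%R.
    transitivity (\sum_(i < N) (-1) ^+ i : int)%R.
      by apply: eq_bigr => i _; rewrite ltnW // mulr1.
    elim: N {JN} => [|N IH]; first by rewrite big_ord0.
    by rewrite big_ord_recr /= IH -signr_odd; case: (odd N).
  by rewrite -signr_odd; case: (odd N).
by rewrite -IH // leqNgt JN mulr0 addr0.
Qed.

Lemma count_sum_int (T : Type) (p : pred T) (r : seq T) :
  Posz (count p r) = (\sum_(x <- r) Posz (p x))%R.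
Proof. by elim: r => [|x r IH]; rewrite ?big_nil // big_cons -IH. Qed.

Lemma dvdn_pmex k A c n : 0 < c -> c <= A ->
  (forall i, sumn (mex_terms A c i) <= n ->
     k %| npart (n - sumn (mex_terms A c i))) ->
  k %| pmex A c n.
Proof.
move=> c0 cA H; have A0 : 0 < A := leq_trans c0 cA.
suff: (Posz k %| Posz (pmex A c n))%Z by [].
rewrite /pmex count_sum_int.
rewrite (eq_big_seq (fun s => \sum_(i < n.+2) (-1) ^+ i *
   Posz (all (mem s) (mex_terms A c i)))%R); last first.
  by move=> s; rewrite mem_partns; apply: mex_signs.
rewrite exchange_big /=; apply: rpred_sum => i _.
rewrite -big_distrr /= -count_sum_int dvdz_mull //.
rewrite count_partns_sub ?uniq_mex_terms //.
  by case: ifP => [/H//|_]; exact: dvdz0.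
by apply/allP => y /mapP[j _ ->]; rewrite addn_gt0 c0.
Qed.

End Partitions.

(** * Formal power series *)

Local Open Scope ring_scope.

(** The record gives the Cauchy product a type of its own. Equality is coefficientwise by functional
    extensionality, and the equality and choice structures are classical. *)
Record fps (R : Type) := Fps { cf : nat -> R }.

Lemma fpsP (R : Type) (f g : fps R) : (forall n, cf f n = cf g n) -> f = g.
Proof. by case: f g => [f] [g] /= h; congr Fps; apply: funext. Qed.

HB.instance Definition _ (R : Type) := gen_eqMixin (fps R).
HB.instance Definition _ (R : Type) := gen_choiceMixin (fps R).

Section FpsRing.
Variable R : comNzRingType.
Implicit Types f g h : fps R.

Definition fps_zero : fps R := Fps (fun=> 0).
Definition fps_opp f : fps R := Fps (fun n => - cf f n).
Definition fps_add f g : fps R := Fps (fun n => cf f n + cf g n).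

Fact fps_addA : associative fps_add.
Proof. by move=> f g h; apply: fpsP => n /=; rewrite addrA. Qed.
Fact fps_addC : commutative fps_add.
Proof. by move=> f g; apply: fpsP => n /=; rewrite addrC. Qed.
Fact fps_add0 : left_id fps_zero fps_add.
Proof. by move=> f; apply: fpsP => n /=; rewrite add0r. Qed.
Fact fps_addN : left_inverse fps_zero fps_opp fps_add.
Proof. by move=> f; apply: fpsP => n /=; rewrite addNr. Qed.

HB.instance Definition _ :=
  GRing.isZmodule.Build (fps R) fps_addA fps_addC fps_add0 fps_addN.

Definition fps_one : fps R := Fps (fun n => (n == 0%N)%:R).
Definition fps_mul f g : fps R :=
  Fps (fun n => \sum_(i < n.+1) cf f i * cf g (n - i)%N).

Definition fps_trunc (N : nat) f : {poly R} := \poly_(i < N) cf f i.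

Lemma coef_mul_agree (p p' q q' : {poly R}) n :
  (forall i, (i <= n)%N -> p`_i = p'`_i) ->
  (forall i, (i <= n)%N -> q`_i = q'`_i) -> (p * q)`_n = (p' * q')`_n.
Proof.
move=> hp hq; rewrite !coefM; apply: eq_bigr => i _.
by rewrite hp ?hq ?leq_subr // -ltnS.
Qed.

Lemma coef_fps_trunc N f n : (n < N)%N -> (fps_trunc N f)`_n = cf f n.
Proof. by move=> h; rewrite coef_poly h. Qed.

(** Transfers the ring laws from polynomials: a coefficient of a product depends only on truncations
    of the factors. *)
Lemma cf_fps_mul N f g n : (n < N)%N ->
  cf (fps_mul f g) n = (fps_trunc N f * fps_trunc N g)`_n.
Proof.
move=> h; rewrite coefM /=; apply: eq_bigr => i _.
rewrite !coef_fps_trunc //; first exact: leq_ltn_trans (leq_subr _ _) h.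
by apply: leq_ltn_trans h; rewrite -ltnS.
Qed.

Fact fps_mulA : associative fps_mul.
Proof.
move=> f g h; apply: fpsP => n.
rewrite !(@cf_fps_mul n.+1) //.
rewrite (@coef_mul_agree _ (fps_trunc n.+1 f) _
  (fps_trunc n.+1 g * fps_trunc n.+1 h)) //; last first.
  by move=> i ilen; rewrite coef_fps_trunc // (@cf_fps_mul n.+1).
rewrite mulrA; apply: coef_mul_agree => // i ilen.
by rewrite coef_fps_trunc // (@cf_fps_mul n.+1).
Qed.
Fact fps_mulC : commutative fps_mul.
Proof.
by move=> f g; apply: fpsP => n; rewrite !(@cf_fps_mul n.+1) // mulrC.
Qed.
Fact fps_mul1 : left_id fps_one fps_mul.
Proof.
move=> f; apply: fpsP => n /=; rewrite big_ord_recl /= mul1r subn0 big1 ?addr0 //.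
by move=> i _; rewrite mul0r.
Qed.
Fact fps_mulDl : left_distributive fps_mul fps_add.
Proof.
move=> f g h; apply: fpsP => n /=; rewrite -big_split /=.
by apply: eq_bigr => i _; rewrite mulrDl.
Qed.
Fact fps_1neq0 : fps_one != fps_zero.
Proof.
by apply/eqP => /(congr1 (fun f => cf f 0)) /= /eqP; rewrite oner_eq0.
Qed.

HB.instance Definition _ :=
  GRing.Zmodule_isComNzRing.Build (fps R) fps_mulA fps_mulC fps_mul1 fps_mulDl
    fps_1neq0.

Lemma cf0 n : cf (0 : fps R) n = 0. Proof. by []. Qed.
Lemma cf1 n : cf (1 : fps R) n = (n == 0%N)%:R. Proof. by []. Qed.
Lemma cfD f g n : cf (f + g) n = cf f n + cf g n. Proof. by []. Qed.
Lemma cfN f n : cf (- f) n = - cf f n. Proof. by []. Qed.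
Lemma cfM f g n : cf (f * g) n = \sum_(i < n.+1) cf f i * cf g (n - i)%N.
Proof. by []. Qed.
Lemma cf_sum (I : Type) (r : seq I) (P : pred I) (F : I -> fps R) n :
  cf (\sum_(i <- r | P i) F i) n = \sum_(i <- r | P i) cf (F i) n.
Proof. by apply: (big_morph (fun f => cf f n)). Qed.

Definition fps_poly (p : {poly R}) : fps R := Fps (fun n => p`_n).

Fact fps_poly_additive : zmod_morphism fps_poly.
Proof. by move=> p q; apply: fpsP => n /=; rewrite coefB. Qed.
HB.instance Definition _ :=
  GRing.isZmodMorphism.Build {poly R} (fps R) fps_poly fps_poly_additive.
Fact fps_poly_monoid : monoid_morphism fps_poly.
Proof.
split; first by apply: fpsP => n /=; rewrite coef1.
by move=> p q; apply: fpsP => n /=; rewrite coefM.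
Qed.
HB.instance Definition _ :=
  GRing.isMonoidMorphism.Build {poly R} (fps R) fps_poly fps_poly_monoid.

Definition fpsX : fps R := fps_poly 'X.
Definition fpsC (c : R) : fps R := fps_poly c%:P.

Lemma cf_Xn k n : cf (fpsX ^+ k) n = (n == k)%:R.
Proof. by rewrite -rmorphXn /= coefXn. Qed.

Lemma cf_XnM k f n : cf (fpsX ^+ k * f) n = if (n < k)%N then 0 else cf f (n - k)%N.
Proof.
rewrite cfM; case: ltnP => hk.
  rewrite big1 // => i _; rewrite cf_Xn (ltn_eqF _) ?mul0r //.
  by apply: leq_trans hk; rewrite ltnS -ltnS.
rewrite (bigD1 (Ordinal (hk : (k < n.+1)%N))) //= cf_Xn eqxx mul1r.
rewrite big1 ?addr0 // => i; rewrite -val_eqE /= => /negbTE hi.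
by rewrite cf_Xn hi mul0r.
Qed.

Lemma cf_CM c f n : cf (fpsC c * f) n = c * cf f n.
Proof.
rewrite cfM big_ord_recl /= coefC /= subn0 big1 ?addr0 // => i _.
by rewrite coefC /= mul0r.
Qed.

Lemma fpsXn_inj k f : fpsX ^+ k * f = 0 -> f = 0.
Proof.
move=> h; apply: fpsP => n.
have : cf (fpsX ^+ k * f) (n + k) = cf (0 : fps R) (n + k) by rewrite h.
by rewrite cf_XnM ltnNge leq_addl addnK.
Qed.

End FpsRing.
Arguments fpsX {R}.

Section FpsMap.
Variables (R S : comNzRingType) (phi : {rmorphism R -> S}).

Definition map_fps (f : fps R) : fps S := Fps (fun n => phi (cf f n)).

Fact map_fps_additive : zmod_morphism map_fps.
Proof. by move=> f g; apply: fpsP => n /=; rewrite rmorphB. Qed.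
HB.instance Definition _ :=
  GRing.isZmodMorphism.Build (fps R) (fps S) map_fps map_fps_additive.
Fact map_fps_monoid : monoid_morphism map_fps.
Proof.
split; first by apply: fpsP => n /=; rewrite rmorph_nat.
move=> f g; apply: fpsP => n /=; rewrite rmorph_sum /=.
by apply: eq_bigr => i _; rewrite rmorphM.
Qed.
HB.instance Definition _ :=
  GRing.isMonoidMorphism.Build (fps R) (fps S) map_fps map_fps_monoid.

Lemma map_fpsX : map_fps fpsX = fpsX.
Proof. by apply: fpsP => n /=; rewrite !coefX rmorph_nat. Qed.
End FpsMap.

(** * The Frobenius map on power series *)

Section FpsFrobenius.
Variables (R : comNzRingType) (p : nat).
Hypotheses (pchR : p \in [pchar R]) (Rfix : forall c : R, c ^+ p = c).

Definition fps_dilate (r : nat) (f : fps R) : fps R :=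
  Fps (fun n => if (r %| n)%N then cf f (n %/ r) else 0).

Lemma cf_dilate r f n :
  cf (fps_dilate r f) n = if (r %| n)%N then cf f (n %/ r) else 0.
Proof. by []. Qed.

(** Horner induction: the [p]-th power is additive in characteristic [p], and [Rfix] makes it fix
    the coefficients. *)
Lemma fps_poly_frobenius (q : {poly R}) n :
  cf (fps_poly q ^+ p) n = if (p %| n)%N then q`_(n %/ p) else 0.
Proof.
rewrite -rmorphXn /=.
have pch : p \in [pchar {poly R}] by rewrite pchar_poly.
elim/poly_ind: q n => [|q c IH] n.
  by rewrite expr0n coef0 (gtn_eqF (prime_gt0 (pcharf_prime pchR))) coef0 if_same.
have -> : (q * 'X + c%:P) ^+ p = q ^+ p * 'X ^+ p + c%:P.
  rewrite exprDn_pchar ?pnatE ?(pcharf_prime pchR) //.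
  by rewrite exprMn -(rmorphXn (@polyC R)) Rfix.
have p0 : (0 < p)%N := prime_gt0 (pcharf_prime pchR).
rewrite coefD coefMXn coefC coefD coefMX coefC.
case: ltnP => hn.
  case: (posnP n) => [->|n0]; first by rewrite dvdn0 div0n.
  by rewrite gtnNdvd // add0r.
rewrite (gtn_eqF (leq_trans p0 hn)) IH addr0.
have -> : (p %| n - p)%N = (p %| n)%N by rewrite dvdn_subl.
case: ifP => // pn.
have -> : (n %/ p == 0)%N = false by rewrite gtn_eqF // divn_gt0.
rewrite -{2}(subnK hn) divnDr // divnn p0 addn1 /= addr0 //.
Qed.

Lemma fps_frobenius f : f ^+ p = fps_dilate p f.
Proof.
have p0 : (0 < p)%N := prime_gt0 (pcharf_prime pchR).
have pch : p \in [pchar (fps R)].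
  rewrite inE (pcharf_prime pchR) /=; apply/eqP; apply: fpsP => n.
  have -> : (p%:R : fps R) = fps_poly (p%:R) by rewrite rmorph_nat.
  by rewrite /= -polyC_natr (pcharf0 pchR) coefC if_same.
apply: fpsP => n.
(* The tail beyond degree [n] turns into a multiple of X^((n+1)p), out of reach of coefficient
   [n]. *)
pose q := fps_trunc n.+1 f.
pose g := Fps (fun i => cf f (i + n.+1)%N).
have -> : f = fps_poly q + fpsX ^+ n.+1 * g.
  apply: fpsP => i; rewrite cfD cf_XnM /= coef_poly; case: ltnP => h.
    by rewrite addr0.
  by rewrite add0r subnK.
have -> : (fps_poly q + fpsX ^+ n.+1 * g) ^+ p =
          fps_poly q ^+ p + fpsX ^+ (n.+1 * p) * g ^+ p.
  rewrite exprDn_pchar ?pnatE ?(pcharf_prime pchR) //.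
  by rewrite exprMn -exprM.
rewrite cfD fps_poly_frobenius cf_XnM.
have -> : (n < n.+1 * p)%N by apply: leq_trans (leq_pmulr _ p0).
rewrite addr0 cf_dilate cfD cf_XnM ltnS leq_div addr0.
by case: ifP.
Qed.
End FpsFrobenius.

Arguments cf : simpl never.

Lemma cfE (R : Type) (u : nat -> R) n : cf (Fps u) n = u n.
Proof. by []. Qed.

(** * Theta series *)

Definition zrange (N : nat) : seq int := [seq (Posz i - Posz N)%R | i <- iota 0 (N + N).+1].

Lemma mem_zrange N z : (z \in zrange N) = (absz z <= N)%N.
Proof.
apply/mapP/idP => [[i]|h].
  rewrite mem_iota; lia.
exists (absz (z + Posz N)); last by lia.
by rewrite mem_iota; lia.
Qed.

Lemma uniq_zrange N : uniq (zrange N).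
Proof. by rewrite map_inj_uniq ?iota_uniq // => a b; lia. Qed.

Lemma big_zrange_widen (R : nmodType) (N K : nat) (Q : pred int) (F : int -> R) :
  (forall n, Q n -> (absz n <= N)%N) -> (N <= K)%N ->
  \sum_(n <- zrange N | Q n) F n = \sum_(n <- zrange K | Q n) F n.
Proof.
move=> hQ NK; rewrite -big_filter -[RHS]big_filter.
apply: perm_big; apply: uniq_perm; rewrite ?filter_uniq ?uniq_zrange //.
move=> z; rewrite !mem_filter !mem_zrange; case hz: (Q z) => //=.
by rewrite (hQ _ hz) (leq_trans (hQ _ hz)).
Qed.

Section Theta.
Variable R : comNzRingType.
Implicit Types (w v : int -> R) (r N K : nat).

(** The sum of w(n) x^(r n^2) over all integers n. For [r > 0] the equation r n^2 = N forces |n| <=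
    N, so the finite range misses nothing. *)
Definition theta r w : fps R :=
  Fps (fun N => \sum_(n <- zrange N | (r * absz n ^ 2 == N)%N) w n).

Lemma sq_leq r N n : (0 < r)%N -> (r * absz n ^ 2 <= N)%N -> (absz n <= N)%N.
Proof. by move=> r0; nia. Qed.

Lemma cf_theta r w N K : (0 < r)%N -> (N <= K)%N ->
  cf (theta r w) N = \sum_(n <- zrange K | (r * absz n ^ 2 == N)%N) w n.
Proof.
move=> r0 NK; apply: big_zrange_widen => // n /eqP h.
by apply: (sq_leq r0); rewrite h.
Qed.

Lemma eq_theta r w v : w =1 v -> theta r w = theta r v.
Proof. by move=> h; apply: fpsP => N; apply: eq_bigr => n _. Qed.

Lemma thetaD r w v : theta r (fun n => w n + v n) = theta r w + theta r v.
Proof. by apply: fpsP => N; rewrite cfD -big_split. Qed.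

Lemma theta_sum r (I : Type) (s : seq I) (w : I -> int -> R) :
  theta r (fun n => \sum_(i <- s) w i n) = \sum_(i <- s) theta r (w i).
Proof.
elim: s => [|i s IH].
  rewrite big_nil; apply: fpsP => N; rewrite cf0.
  by apply: big1 => n _; rewrite big_nil.
rewrite big_cons -IH -thetaD; apply: eq_theta => n; exact: big_cons.
Qed.

Lemma thetaZ r c w : theta r (fun n => c * w n) = fpsC c * theta r w.
Proof. by apply: fpsP => N; rewrite cf_CM /= big_distrr. Qed.

Definition zrange2 N : seq (int * int) := [seq (a, b) | a <- zrange N, b <- zrange N].

Lemma cf_thetaM r w v N : (0 < r)%N ->
  cf (theta r w * theta r v) N =
  \sum_(p <- zrange2 N | (r * (absz p.1 ^ 2 + absz p.2 ^ 2) == N)%N) w p.1 * v p.2.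
Proof.
move=> r0; rewrite cfM [RHS]big_mkcond big_allpairs /=.
transitivity (\sum_(i < N.+1) \sum_(a <- zrange N) \sum_(b <- zrange N)
   if (r * absz a ^ 2 == i)%N && (r * absz b ^ 2 == N - i)%N then w a * v b else 0).
  apply: eq_bigr => i _.
  rewrite (@cf_theta r w i N) // ?(@cf_theta r v (N - i) N) // ?leq_subr //; last first.
    by rewrite -ltnS.
  rewrite big_mkcond big_distrl /=; apply: eq_bigr => a _.
  case: eqP => _ /=; last by rewrite mul0r big1.
  rewrite big_mkcond big_distrr /=; apply: eq_bigr => b _.
  by case: eqP => // _; rewrite mulr0.
rewrite exchange_big; apply: eq_bigr => a _.
rewrite exchange_big; apply: eq_bigr => b _.
case: (leqP (r * absz a ^ 2) N) => h; last first.
  rewrite big1 => [|i _]; last first.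
    by case: eqP => // e; move: h; rewrite e ltnNge -ltnS ltn_ord.
  by case: eqP => // e; move: h; rewrite -e mulnDr ltnNge leq_addr.
rewrite (bigD1 (Ordinal (h : (r * absz a ^ 2 < N.+1)%N))) //= eqxx /=.
rewrite big1 ?addr0 => [|i]; last first.
  by rewrite -val_eqE eq_sym /= => /negbTE ->.
by congr (if _ then _ else _); rewrite mulnDr; lia.
Qed.

Lemma absz_sqE (z : int) : Posz (absz z ^ 2) = z * z.
Proof. by rewrite -abszX /= gez0_abs ?sqr_ge0 // expr2. Qed.

Lemma absz_sq_rotate (s t : int) :
  (absz (s + t)%R ^ 2 + absz (s - t)%R ^ 2 = 2 * (absz s ^ 2 + absz t ^ 2))%N.
Proof.
by apply/eqP; rewrite -eqz_nat PoszM !PoszD !absz_sqE; apply/eqP; ring.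
Qed.

(** The map (s, t) -> (s + t, s - t) is a bijection from pairs of integers onto pairs of equal
    parity and doubles the sum of squares; [W] vanishes on the other pairs. *)
Lemma sum_rotate (W : int -> int -> R) N :
  (forall a b, ~~ (2 %| a - b)%Z -> W a b = 0) ->
  \sum_(p <- zrange2 N | (1 * (absz p.1 ^ 2 + absz p.2 ^ 2) == N)%N) W p.1 p.2 =
  \sum_(p <- zrange2 N | (2 * (absz p.1 ^ 2 + absz p.2 ^ 2) == N)%N)
     W (p.1 + p.2) (p.1 - p.2).
Proof.
move=> hW; pose ev (p : int * int) := (2 %| p.1 - p.2)%Z.
have uq : uniq (zrange2 N) by apply: allpairs_uniq; rewrite ?uniq_zrange // => -[? ?] [].
have mq p : (p \in zrange2 N) = (absz p.1 <= N)%N && (absz p.2 <= N)%N.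
  rewrite -!mem_zrange; apply/allpairsP/andP => [[[a b] [ha hb ->]]|[]] //.
  by case: p => a b /= ha hb; exists (a, b).
move: (zrange2 N) uq mq => L uq mq.
rewrite (bigID ev) /= [X in _ + X]big1 ?addr0; last first.
  by move=> p /andP[_]; apply: hW.
rewrite -big_filter -[RHS]big_filter.
rewrite -(big_map (fun p : int * int => (p.1 + p.2, p.1 - p.2)) xpredT
  (fun p => W p.1 p.2)).
apply: perm_big; apply: uniq_perm; first by rewrite filter_uniq.
  rewrite map_inj_uniq ?filter_uniq // => -[a b] [c d] /= [h1 h2].
  by congr (_, _); lia.
move=> [a b]; rewrite mem_filter mq /ev; apply/idP/mapP.
  case/andP=> /andP[/eqP/= hN /dvdzP/=[t ht]] /= hab.
  have ea : a = b + t * 2 by rewrite -ht addrC subrK.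
  exists ((b + t : int)%R, t : int); last by rewrite /= ea; congr (_, _); ring.
  have hN2 : (2 * (absz (b + t)%R ^ 2 + absz t ^ 2))%N = N.
    rewrite -absz_sq_rotate -hN ea mul1n.
    by congr (absz _ ^ 2 + absz _ ^ 2)%N; ring.
  rewrite mem_filter mq /= hN2 eqxx /=.
  by apply/andP; split; apply: (@sq_leq 2); rewrite // -hN2 leq_mul2l ?leq_addr ?leq_addl.
case=> -[s t]; rewrite mem_filter mq => /andP[/eqP/= hN hst] [-> ->].
have hN1 : (1 * (absz (s + t)%R ^ 2 + absz (s - t)%R ^ 2))%N = N.
  by rewrite mul1n absz_sq_rotate.
rewrite hN1 eqxx /=; apply/andP; split; first by apply/dvdzP; exists t; ring.
by apply/andP; split; apply: (@sq_leq 1); rewrite // -hN1 leq_mul2l ?leq_addr ?leq_addl.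
Qed.
End Theta.

(** * Addition formulas *)

Section ThetaNull.
Variable mu : nat.
Hypothesis mu_gt0 : (0 < mu)%N.
Local Notation M := (2 * Posz mu).

Definition residue_ind (c n : int) : int := ((2 * Posz mu) %| n - c)%Z%:R.
(** A class modulo [mu] is the union of the classes of [c] and [c + mu] modulo [2 mu]: their
    indicators are added for [b = false] and subtracted for [b = true]. *)
Definition half_char (b : bool) (c n : int) : int :=
  if (Posz mu %| n - c)%Z then (-1) ^+ (b && odd (absz ((n - c) %/ Posz mu)%Z)) else 0.

Definition tnull (c : int) : fps int := theta 1 (residue_ind c).

(** Each condition on the left forces s = a mu and t = c mu. The first then says that a + c is even,
    the second that it is odd, so the left side is the sign (-1)^(b (a + c)). *)
Lemma half_char_rotate (b : bool) (s t : int) :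
  ((M %| s + t)%Z && (M %| s - t)%Z)%:R +
  (-1) ^+ b * ((M %| s + t - Posz mu)%Z && (M %| s - t - Posz mu)%Z)%:R =
  half_char b 0 s * half_char b 0 t.
Proof.
have mu0 : Posz mu != 0 by rewrite eqz_nat -lt0n.
rewrite /half_char !subr0.
case: (boolP (Posz mu %| s)%Z) => [/dvdzP[a ->]|hs]; last first.
  rewrite mul0r; case: andP => [[/dvdzP[x hx] /dvdzP[y hy]]|_].
    by case/negP: hs; apply/dvdzP; exists (x + y); lia.
  case: andP => [[/dvdzP[x hx] /dvdzP[y hy]]|_]; last by rewrite mulr0 addr0.
  by case/negP: hs; apply/dvdzP; exists (x + y + 1); lia.
case: (boolP (Posz mu %| t)%Z) => [/dvdzP[c ->]|ht]; last first.
  rewrite mulr0; case: andP => [[/dvdzP[x hx] /dvdzP[y hy]]|_].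
    by case/negP: ht; apply/dvdzP; exists (x - y); lia.
  case: andP => [[/dvdzP[x hx] /dvdzP[y hy]]|_]; last by rewrite mulr0 addr0.
  by case/negP: ht; apply/dvdzP; exists (x - y); lia.
rewrite !mulzK // -mulrDl -mulrBl.
have e1 (z : int) : z * Posz mu - Posz mu = (z - 1) * Posz mu by ring.
rewrite !e1 !dvdz_mul2r //.
have -> : (2 %| a + c)%Z = ~~ (odd (absz a) (+) odd (absz c)) by lia.
have -> : (2 %| a - c)%Z = ~~ (odd (absz a) (+) odd (absz c)) by lia.
have -> : (2 %| a + c - 1)%Z = odd (absz a) (+) odd (absz c) by lia.
have -> : (2 %| a - c - 1)%Z = odd (absz a) (+) odd (absz c) by lia.
by case: b; case: (odd (absz a)); case: (odd (absz c)).
Qed.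

Lemma cf_signM (b : bool) (f : fps int) n : cf ((-1) ^+ b * f) n = (-1) ^+ b * cf f n.
Proof. by case: b; rewrite ?expr0 ?expr1 ?mul1r // !mulN1r cfN. Qed.

(* The substitution [(s, t) -> (s + t, s - t)] in the double sum. *)
Lemma tnull_addition (b : bool) (c d : int) :
  tnull (c + d) * tnull (c - d) +
    (-1) ^+ b * (tnull (c + d + Posz mu) * tnull (c - d + Posz mu)) =
  theta 2 (half_char b c) * theta 2 (half_char b d).
Proof.
apply: fpsP => N; rewrite cfD cf_signM !cf_thetaM // big_distrr -big_split /=.
pose W (x y : int) := residue_ind (c + d) x * residue_ind (c - d) y +
  (-1) ^+ b * (residue_ind (c + d + Posz mu) x * residue_ind (c - d + Posz mu) y).
have WE x y : W x y =
  ((M %| x - (c + d))%Z && (M %| y - (c - d))%Z)%:R +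
  (-1) ^+ b * ((M %| x - (c + d + Posz mu))%Z && (M %| y - (c - d + Posz mu))%Z)%:R.
  by rewrite /W /residue_ind -!natrM !mulnb.
rewrite (@sum_rotate _ W) => [|x y hxy]; last first.
  rewrite WE; case: andP => [[/dvdzP[u hu] /dvdzP[v hv]]|_].
    by case/negP: hxy; apply/dvdzP; exists (Posz mu * (u - v) + d); lia.
  case: andP => [[/dvdzP[u hu] /dvdzP[v hv]]|_]; last by rewrite mulr0 addr0.
  by case/negP: hxy; apply/dvdzP; exists (Posz mu * (u - v) + d); lia.
apply: eq_bigr => -[s t] _ /=.
have := half_char_rotate b (s - c) (t - d).
rewrite {1 2}/half_char !subr0 -!/(half_char _ _ _) => <-; rewrite WE.
by congr (_%:R + _ * _%:R); congr (_ && _); congr dvdz; ring.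
Qed.

Local Notation T := tnull.
Local Notation U c := (tnull (c + Posz mu)).

Lemma tnull_modz (c d : int) : (M %| c - d)%Z -> T c = T d.
Proof.
move=> /dvdzP[k hk]; apply: eq_theta => n; rewrite /residue_ind; congr (_%:R).
have e : n - d = n - c + k * M by rewrite -hk; ring.
apply: congr1; apply/dvdzP/dvdzP => -[x hx].
  by exists (x + k); rewrite e hx; ring.
by exists (x - k); rewrite mulrBl -hx e addrK.
Qed.

(** The rewriting rule that lowers the exponent of T_c: at most T_c^4 is left on the right, and the
    other factors are T_0, U_0, T_(2c), U_(2c). The integer 16 clears denominators. *)
Lemma tnull_pow8 c : 16%:R * T c ^+ 8 =
  16%:R * (T c ^+ 4 * (T 0 ^+ 3 * T (c + c) + U 0 ^+ 3 * U (c + c))) -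
  4%:R * (T 0 ^+ 2 * U 0 ^+ 2 * (T 0 * U (c + c) + U 0 * T (c + c)) ^+ 2).
Proof.
(* The addition formula at (c, 0), squared, equals the product of those at (c, c) and (0, 0). *)
have key (b : bool) : (T c ^+ 2 + (-1) ^+ b * U c ^+ 2) ^+ 2 =
    (T 0 ^+ 2 + (-1) ^+ b * U 0 ^+ 2) *
    (T (c + c) * T 0 + (-1) ^+ b * (U (c + c) * U 0)).
  have := tnull_addition b c 0; have := tnull_addition b c c.
  have := tnull_addition b 0 0; rewrite ?addr0 ?subr0 ?subrr ?addr0 ?add0r -?expr2.
  by move=> -> -> ->; rewrite exprMn mulrC.
have := key true; have := key false; rewrite expr0 expr1 !mulN1r !mul1r.
move: (T c) (U c) (T 0) (U 0) (T (c + c)) (U (c + c)) => t u t0 u0 t2 u2 e1 e2.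
(* This is t^8 = t^4 (t^4 + u^4) - (t^2 u^2)^2, written through the two squares supplied by
   [key]. *)
have : 16%:R * t ^+ 8 = 8%:R * t ^+ 4 * ((t ^+ 2 + u ^+ 2) ^+ 2 + (t ^+ 2 - u ^+ 2) ^+ 2)
   - ((t ^+ 2 + u ^+ 2) ^+ 2 - (t ^+ 2 - u ^+ 2) ^+ 2) ^+ 2 by ring.
by rewrite e1 e2 => ->; ring.
Qed.

End ThetaNull.

(** * Homogeneous polynomials in theta constants *)

Section FractionDenominator.
Local Open Scope quotient_scope.

Lemma frac_denominator (R : idomainType) (x : {fraction R}) :
  exists d n : R, d != 0 /\ tofrac d * x = tofrac n.
Proof.
elim/quotW: x => r; exists \d_r, \n_r; split; first exact: denom_ratioP.
rewrite -[_ * _]/(FracField.mul _ _) !piE /=.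
apply/eqmodP; rewrite /= FracField.equivfE /FracField.mulf.
rewrite !numden_Ratio ?oner_eq0 ?mulf_neq0 ?denom_ratioP ?oner_neq0 //.
by rewrite mulr1 mul1r.
Qed.

End FractionDenominator.

(** With more rows than columns the matrix has a nonzero left kernel vector over the fraction field;
    multiplying it by all its denominators brings it back to [R]. *)
Lemma linear_dependence (R : idomainType) (I J : finType) (A : I -> J -> R) :
  (#|J| < #|I|)%N ->
  exists d : I -> R, (exists i, d i != 0) /\ forall j, \sum_i d i * A i j = 0.
Proof.
move=> JI.
pose B : 'M[{fraction R}]_(#|I|, #|J|) :=
  \matrix_(i, j) tofrac (A (enum_val i) (enum_val j)).
have : kermx B != 0.
  rewrite -mxrank_eq0 mxrank_ker subn_eq0 -ltnNge.
  exact: leq_ltn_trans (rank_leq_col _) JI.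
case/rowV0Pn => v /sub_kermxP hv v0.
have /fin_all_exists [den hden] (i : 'I_#|I|) : exists d, exists n : R,
  d != 0 /\ tofrac d * v 0 i = tofrac n by apply: frac_denominator.
have /fin_all_exists [num hnum] (i : 'I_#|I|) : exists n : R,
  den i != 0 /\ tofrac (den i) * v 0 i = tofrac n by apply: hden.
pose d i := num i * \prod_(k | k != i) den k.
have hd i : tofrac (d i) = tofrac (\prod_k den k) * v 0 i.
  rewrite (bigD1 i) //= !rmorphM /= -(hnum i).2; ring.
have den0 : \prod_k den k != 0 by apply/prodf_neq0 => k _; case: (hnum k).
exists (fun i => d (enum_rank i)); split.
  case/rV0Pn: v0 => i hi; exists (enum_val i); rewrite enum_valK.
  by rewrite -tofrac_eq0 hd mulf_neq0 // tofrac_eq0.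
move=> j; apply/eqP; rewrite -tofrac_eq0 rmorph_sum /=.
have := congr1 (fun M : 'rV_#|J| => M 0 (enum_rank j)) hv.
rewrite !mxE => h.
rewrite (reindex_onto (enum_val (A := predT)) enum_rank) /=; last first.
  by move=> i _; rewrite enum_rankK.
rewrite (eq_bigl xpredT) => [|i]; last by rewrite enum_valK eqxx.
rewrite (eq_bigr (fun i => tofrac (\prod_k den k) * (v 0 i * B i (enum_rank j)))).
  by rewrite -mulr_sumr h mulr0.
by move=> i _; rewrite enum_valK rmorphM /= hd mxE enum_rankK mulrA.
Qed.

(** * Forms in the theta constants and their linear span *)

Section Homogeneous.
Variable mu : nat.
Hypothesis mu_gt0 : (0 < mu)%N.
Local Notation m := (2 * mu)%N.
Local Notation t0 := (tnull mu 0).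
Local Notation u0 := (tnull mu (Posz mu)).
Definition tn (i : 'I_m) : fps int := tnull mu (Posz i).
Definition tword (s : seq 'I_m) : fps int := \prod_(i <- s) tn i.

(** The values at the theta constants of integral forms of degree [K]. As a predicate on series it
    avoids a polynomial ring in [2 mu] variables. *)
Inductive hom : nat -> fps int -> Prop :=
| hom_word (c : int) (s : seq 'I_m) : hom (size s) (c%:~R * tword s)
| hom_add K f g : hom K f -> hom K g -> hom K (f + g).

Fact m_gt0 : (0 < m)%N. Proof. by rewrite muln_gt0. Qed.
Definition tmod (n : nat) : 'I_m := Ordinal (ltn_pmod n m_gt0).

Lemma tn_tmod n : tn (tmod n) = tnull mu (Posz n).
Proof.
apply: tnull_modz; apply/dvdzP; exists (- Posz (n %/ m)%N) => /=.
have := divn_eq n m; lia.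
Qed.

Lemma hom0 K : hom K 0.
Proof.
have := hom_word 0 (nseq K (tmod 0)); by rewrite size_nseq mul0r.
Qed.

Lemma hom_sum K (I : Type) (r : seq I) (P : pred I) (F : I -> fps int) :
  (forall i, P i -> hom K (F i)) -> hom K (\sum_(i <- r | P i) F i).
Proof. by move=> h; apply: big_ind => //; [exact: hom0 | exact: hom_add]. Qed.

Lemma hom1 : hom 0 1.
Proof. by have := hom_word 1 [::]; rewrite /tword big_nil mulr1. Qed.

Lemma hom_tn i : hom 1 (tn i).
Proof. by have := hom_word 1 [:: i]; rewrite /tword big_seq1 mul1r. Qed.

Lemma homM a b f g : hom a f -> hom b g -> hom (a + b) (f * g).
Proof.
move=> hf; elim: hf b g => {a f} [c s|a f f' _ IH _ IH'] b g hg; last first.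
  by rewrite mulrDl; apply: hom_add; [exact: IH | exact: IH'].
elim: hg => {b g} [d t|b g g' _ IH _ IH']; last first.
  by rewrite mulrDr; apply: hom_add.
have := hom_word (c * d) (s ++ t).
by rewrite size_cat /tword big_cat intrM mulrACA.
Qed.

Lemma homZ (c : int) K f : hom K f -> hom K (c%:~R * f).
Proof.
move=> hf; rewrite -[K]add0n; apply: homM => //.
by have := hom_word c [::]; rewrite /tword big_nil mulr1.
Qed.

Lemma homX a f k : hom a f -> hom (a * k) (f ^+ k).
Proof.
move=> hf; elim: k => [|k IH]; first by rewrite muln0 expr0; exact: hom1.
by rewrite exprS mulnS; apply: homM.
Qed.

Lemma hom_prod1 n (F : 'I_n -> fps int) :
  (forall i, hom 1 (F i)) -> hom n (\prod_i F i).
Proof.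
elim: n F => [|n IH] F h; first by rewrite big_ord0; exact: hom1.
by rewrite big_ord_recl; apply: (@homM 1 n) => //; apply: IH.
Qed.

Lemma fpsC_int (c : int) : fpsC c = c%:~R.
Proof. by rewrite -[c in LHS]intz /fpsC !rmorph_int. Qed.

(** A weight of period [2 mu] is the combination of residue indicators whose coefficients are its
    own values. *)
Lemma hom_theta w : (forall n, w (n + Posz m) = w n) -> hom 1 (theta 1 w).
Proof.
move=> hw.
have wnat k n : w (n + Posz (k * m)%N) = w n.
  elim: k n => [|k IH] n; first by rewrite addr0.
  by rewrite mulSn PoszD addrA IH hw.
have -> : theta 1 w = \sum_(i : 'I_m) (w (Posz i))%:~R * tn i.
  rewrite (eq_bigr (fun i : 'I_m => theta 1 (fun n => w (Posz i) * residue_ind mu (Posz i) n))); last first.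
    by move=> i _; rewrite thetaZ; rewrite fpsC_int.
  rewrite -theta_sum; apply: eq_theta => n.
  pose r := absz (n %% Posz m)%Z.
  have rm : (r < m)%N by have := m_gt0; rewrite /r; lia.
  rewrite (bigD1 (Ordinal rm)) //= /residue_ind.
  have hr : Posz r = (n %% Posz m)%Z by have := m_gt0; rewrite /r; lia.
  have hn := divz_eq n (Posz m).
  have -> : (2 * Posz mu %| n - Posz r)%Z.
    by apply/dvdzP; exists (n %/ Posz m)%Z; rewrite hr {1}hn addrK PoszM.
  rewrite mulr1 big1 ?addr0 => [|i]; last first.
    rewrite -val_eqE /= => ir; case: dvdzP => [[k hk]|]; last by rewrite mulr0.
    case/negP: ir; rewrite -eqz_nat hr.
    have -> : n = k * Posz m + Posz i by rewrite PoszM -hk subrK.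
    rewrite modzMDl modz_small //; have := ltn_ord i; lia.
  have : exists q : nat, n = Posz r + Posz (q * m)%N \/ Posz r = n + Posz (q * m)%N.
    exists (absz (n %/ Posz m)%Z); rewrite PoszM hr.
    case: (lerP 0 (n %/ Posz m)%Z) => h; [left | right].
      by rewrite gez0_abs // addrC.
    by rewrite ltz0_abs // {2}hn; ring.
  by case=> q [->|->]; rewrite wnat.
by apply: hom_sum => i _; apply: homZ; exact: hom_tn.
Qed.

(** Products in which every T_i has exponent below 8, filled up with powers of T_0 and U_0. The
    subtraction truncates, so some indices give a degree other than [K]; what matters is a spanning
    family with (K+1) 8^(2 mu) members. *)
Definition reduced K (x : 'I_K.+1 * {ffun 'I_m -> 'I_8}) : fps int :=
  t0 ^+ x.1 * u0 ^+ (K - x.1 - \sum_i x.2 i) * \prod_i tn i ^+ x.2 i.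

(** Membership in the rational span, with an explicit denominator [N] that absorbs the factor 16 of
    [tnull_pow8]. *)
Definition rspan K (f : fps int) : Prop :=
  exists N : int, N != 0 /\ exists c : 'I_K.+1 * {ffun 'I_m -> 'I_8} -> int,
    N%:~R * f = \sum_x (c x)%:~R * reduced x.

Lemma rspanD K f g : rspan K f -> rspan K g -> rspan K (f + g).
Proof.
move=> [N [N0 [c hc]]] [N' [N'0 [c' hc']]].
exists (N * N'); split; first by rewrite mulf_neq0.
exists (fun x => N' * c x + N * c' x).
have -> : (N * N')%:~R * (f + g) = N'%:~R * (N%:~R * f) + N%:~R * (N'%:~R * g).
  by rewrite intrM; ring.
rewrite hc hc' !mulr_sumr -big_split; apply: eq_bigr => x _ /=.
by rewrite intrD !intrM; ring.
Qed.

Lemma rspanZ K (a : int) f : rspan K f -> rspan K (a%:~R * f).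
Proof.
move=> [N [N0 [c hc]]]; exists N; split => //; exists (fun x => a * c x).
rewrite mulrCA hc mulr_sumr; apply: eq_bigr => x _; by rewrite intrM mulrA.
Qed.

Lemma rspan_cancel K (a : int) f : a != 0 -> rspan K (a%:~R * f) -> rspan K f.
Proof.
move=> a0 [N [N0 [c hc]]]; exists (N * a); rewrite mulf_neq0 //; split => //.
by exists c; rewrite intrM -mulrA.
Qed.

Lemma tword_cons i s : tword (i :: s) = tn i * tword s.
Proof. exact: big_cons. Qed.

Lemma tword_count s : tword s = \prod_i tn i ^+ count_mem i s.
Proof.
elim: s => [|j s IH]; first by rewrite /tword big_nil big1.
rewrite tword_cons IH (bigD1 j) //= [RHS](bigD1 j) //= eqxx exprS mulrA.
by congr (_ * _); apply: eq_bigr => i /negbTE ij; rewrite eq_sym ij.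
Qed.

Lemma sum_count s : (\sum_(i : 'I_m) count_mem i s = size s)%N.
Proof.
elim: s => [|j s IH]; first by rewrite big1.
rewrite /= big_split /= IH (bigD1 j) //= eqxx big1 ?addn0 ?add1n // => i /negbTE ij.
by rewrite eq_sym ij.
Qed.

Lemma tword_split k i s : (k <= count_mem i s)%N ->
  exists s', size s = (k + size s')%N /\ tword s = tn i ^+ k * tword s'.
Proof.
elim: k s => [|k IH] s h; first by exists s; rewrite mul1r.
have is_s : i \in s by rewrite -has_pred1 has_count (leq_trans _ h).
have hp := perm_to_rem is_s.
case: (IH (rem i s)) => [|s' [hs' hw]].
  by move: h; rewrite (permP hp) /= eqxx add1n ltnS.
exists s'; rewrite (perm_size hp) /= hs'; split=> //.
have -> : tword s = tn i * tword (rem i s) by rewrite /tword (perm_big _ hp) big_cons.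
by rewrite hw exprS mulrA.
Qed.

(** A letter occurring eight times is rewritten by [tnull_pow8]. The total degree stays [K] while
    the word loses at least three letters to T_0 and U_0, so the process ends with all
    multiplicities below 8. *)
Lemma rspan_word K a b s : (a + b + size s)%N = K ->
  rspan K (t0 ^+ a * u0 ^+ b * tword s).
Proof.
have [n] := ubnP (size s); elim: n s a b => // n IH s a b; rewrite ltnS => sn hK.
case: (boolP [exists i, (8 <= count_mem i s)%N]) => [/existsP[i hi]|/existsPn hs].
  have [s' [ss hw]] := tword_split hi.
  pose j := tmod (i + i); pose j' := tmod (i + i + mu).
  have e2 : tnull mu (Posz i + Posz i) = tn j by rewrite tn_tmod PoszD.
  have e2' : tnull mu (Posz i + Posz i + Posz mu) = tn j' by rewrite tn_tmod !PoszD.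
  have h8 := tnull_pow8 mu_gt0 (Posz i).
  rewrite e2 e2' add0r -/(tn i) in h8.
  apply: (@rspan_cancel K 16) => //.
  have -> : 16%:~R * (t0 ^+ a * u0 ^+ b * tword s) =
     16%:~R * (t0 ^+ (a + 3) * u0 ^+ b * tword [:: i, i, i, i, j & s']) +
     (16%:~R * (t0 ^+ a * u0 ^+ (b + 3) * tword [:: i, i, i, i, j' & s']) +
     ((-4)%:~R * (t0 ^+ (a + 4) * u0 ^+ (b + 2) * tword [:: j', j' & s']) +
     ((-8)%:~R * (t0 ^+ (a + 3) * u0 ^+ (b + 3) * tword [:: j, j' & s']) +
     (-4)%:~R * (t0 ^+ (a + 2) * u0 ^+ (b + 4) * tword [:: j, j & s'])))).
    rewrite hw; transitivity (t0 ^+ a * u0 ^+ b * tword s' * (16%:R * tn i ^+ 8)); first by ring.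
    by rewrite h8 !tword_cons !exprD; ring.
  clear hw h8; move: sn hK; rewrite ss => sn hK.
  by do 4 (apply: rspanD; first (apply: rspanZ; apply: IH => /=;
    move: (size s') sn hK => z; lia));
    apply: rspanZ; apply: IH => /=; move: (size s') sn hK => z; lia.
exists 1; split=> //.
have aK : (a < K.+1)%N by lia.
have hc i : (count_mem i s < 8)%N by rewrite ltnNge hs.
pose x : 'I_K.+1 * {ffun 'I_m -> 'I_8} := (Ordinal aK, [ffun i => Ordinal (hc i)]).
exists (fun y => (y == x)%:R).
rewrite mul1r (bigD1 x) //= eqxx mul1r big1 ?addr0 => [|y /negbTE ->]; last by rewrite mul0r.
rewrite /reduced /= tword_count; congr (_ * _ ^+ _ * _).
  rewrite (eq_bigr (fun i => count_mem i s)) => [|i _]; last by rewrite ffunE.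
  by rewrite sum_count -hK -addnA addKn addnK.
by apply: eq_bigr => i _; rewrite ffunE.
Qed.

Lemma rspan_hom K f : hom K f -> rspan K f.
Proof.
elim=> {K f} [c s|K f g _ hf _ hg]; last exact: rspanD.
by apply: rspanZ; have := @rspan_word (size s) 0 0 s erefl; rewrite !expr0 !mul1r.
Qed.

(* The bound is linear in [K]: the ring generated by the theta constants has
   dimension two. *)
Lemma hom_dependent (I : finType) K (f : I -> fps int) :
  (forall i, hom K (f i)) -> (K.+1 * 8 ^ m < #|I|)%N ->
  exists d : I -> int, (exists i, d i != 0) /\ \sum_i (d i)%:~R * f i = 0.
Proof.
move=> hf hI.
have /fin_all_exists [N hN] i : exists N : int, N != 0 /\ exists c : 'I_K.+1 * {ffun 'I_m -> 'I_8} -> int,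
    N%:~R * f i = \sum_x (c x)%:~R * reduced x := rspan_hom (hf i).
have /fin_all_exists [c hc] i : exists c : 'I_K.+1 * {ffun 'I_m -> 'I_8} -> int,
    N i != 0 /\ (N i)%:~R * f i = \sum_x (c x)%:~R * reduced x.
  by case: (hN i) => N0 [c hc]; exists c.
have := @linear_dependence int I _ c.
rewrite card_prod card_ord card_ffun !card_ord => /(_ hI) [d [[i di] hd]].
exists (fun i => d i * N i); split.
  by exists i; rewrite mulf_neq0 //; case: (hc i).
rewrite (eq_bigr (fun i => \sum_x (d i * c i x)%:~R * reduced x)); last first.
  move=> k _; rewrite intrM -mulrA (hc k).2 mulr_sumr.
  by apply: eq_bigr => x _; rewrite intrM mulrA.
rewrite exchange_big big1 // => x _.
by rewrite -mulr_suml -(rmorph_sum (@intmul (fps int) 1)) hd mul0r.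
Qed.
End Homogeneous.

(** * The pentagonal number theorem *)

Fixpoint tri (n : nat) : nat := if n is n'.+1 then (n + tri n')%N else 0%N.

Lemma tri2 n : (2 * tri n = n * n.+1)%N.
Proof. by elim: n => //= n IH; rewrite mulnDr IH; lia. Qed.

(** The generalised pentagonal number k (3k + 1) / 2, in the shape [s * n + tri s] of the exponents
    of Shanks' sum, with s = n or s = n + 1. *)
Definition pent (k : int) : nat :=
  match k with
  | Posz n => (n * n + tri n)%N
  | Negz n => (n.+1 * n + tri n.+1)%N
  end.

Lemma pentE k : (24 * pent k + 1 = absz (6 * k + 1)%R ^ 2)%N.
Proof.
apply/eqP; rewrite -eqz_nat absz_sqE; apply/eqP.
case: k => n; rewrite /pent.
  by have := tri2 n; rewrite PoszD PoszM PoszD; lia.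
by have := tri2 n.+1; rewrite NegzE; lia.
Qed.

Section Shanks.
Variables (R : comNzRingType) (y : R).

Definition qprod (s n : nat) : R := \prod_(s <= i < n) (1 - y ^+ i.+1).

Definition shanks (n : nat) : R :=
  \sum_(s < n.+1) (-1) ^+ s * qprod s n * y ^+ (s * n + tri s).

Lemma qprod_recr s n : (s <= n)%N -> qprod s n.+1 = qprod s n * (1 - y ^+ n.+1).
Proof. by move=> h; rewrite /qprod big_nat_recr. Qed.
Lemma qprod_recl s n : (s < n)%N -> qprod s n = (1 - y ^+ s.+1) * qprod s.+1 n.
Proof. by move=> h; rewrite /qprod big_ltn. Qed.
Lemma qprodnn n : qprod n n = 1.
Proof. by rewrite /qprod big_geq. Qed.

Lemma shanksS n : shanks n.+1 = shanks n +
  (-1) ^+ n.+1 * (y ^+ pent (Posz n.+1) + y ^+ pent (- Posz n.+1)).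
Proof.
(* Telescoping certificate: the [s]-th summand changes by [d s - d s.+1] from [n] to [n.+1]. The
   boundary value [- d n.+1] is the pentagonal term of index -(n+1), and the new last summand the
   one of index n+1. *)
pose d s := if s is s'.+1 then (-1) ^+ s' * qprod s' n * y ^+ (s * n + tri s) else 0.
rewrite /shanks big_ord_recr /= qprodnn.
have -> : \sum_(s < n.+1) (-1) ^+ s * qprod s n.+1 * y ^+ (s * n.+1 + tri s) =
   \sum_(s < n.+1) ((-1) ^+ s * qprod s n * y ^+ (s * n + tri s) + (d s - d s.+1)).
  apply: eq_bigr => -[[|s] hs] _ /=.
    rewrite qprod_recr // /d (_ : (1 * n + tri 1 = n.+1)%N); last by rewrite /=; lia.
    by rewrite !mul0n /= addn0 !expr0; ring.
  rewrite qprod_recr // /d (@qprod_recl s n hs).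
  have -> : (s.+1 * n.+1 + tri s.+1 = (s.+1 * n + tri s.+1) + s.+1)%N by lia.
  have -> : (s.+2 * n + tri s.+2 = (s.+1 * n + tri s.+1) + n.+1 + s.+1)%N by rewrite /=; lia.
  by rewrite !exprD !exprS; ring.
rewrite big_split /= -addrA; congr (_ + _).
have -> : \sum_(s < n.+1) (d s - d s.+1) = - d n.+1.
  elim: n.+1 => [|k IH]; first by rewrite big_ord0 oppr0.
  by rewrite big_ord_recr /= IH; ring.
by rewrite /d qprodnn [(-1) ^+ n.+1]exprS /=; ring.
Qed.

Lemma big_zrangeS (V : nmodType) n (F : int -> V) :
  \sum_(k <- zrange n.+1) F k =
  F (Posz n.+1) + F (- Posz n.+1) + \sum_(k <- zrange n) F k.
Proof.
transitivity (\sum_(k <- [:: Posz n.+1, - Posz n.+1 & zrange n]) F k); last first.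
  by rewrite !big_cons addrA.
apply: perm_big.
have := uniq_zrange n.+1; have := uniq_zrange n.
have := mem_zrange n.+1; have := mem_zrange n.
move: (zrange n) (zrange n.+1) => r r' hr hr' ur ur'.
apply: uniq_perm => // [|z]; last by rewrite !inE hr hr'; lia.
by rewrite !cons_uniq inE !hr ur andbT; lia.
Qed.

(* Shanks' finite form of the pentagonal number theorem. *)
Lemma shanks_pentagonal n :
  shanks n = \sum_(k <- zrange n) (-1) ^+ absz k * y ^+ pent k.
Proof.
elim: n => [|n IH].
  by rewrite /shanks big_ord1 qprodnn /zrange /= big_seq1 /= !mul1r.
rewrite shanksS IH big_zrangeS abszN /= mulrDr; ring.
Qed.
End Shanks.

(** At n = 6k + 1 the weight is (-1)^k, and it vanishes elsewhere: [theta 1 eta_char] is Dedekind's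
    eta(24 z) as a series in x = exp(2 pi i z). *)
Definition eta_char (n : int) : int :=
  if (12%Z %| n - 1)%Z then 1 else if (12%Z %| n - 7%Z)%Z then -1 else 0.

Definition partition_series : fps int :=
  fps_dilate 24 (Fps (fun n => Posz (npart n))).

Lemma cf_mul_agree (R : comNzRingType) (f f' g g' : fps R) N :
  (forall i, (i <= N)%N -> cf f i = cf f' i) ->
  (forall i, (i <= N)%N -> cf g i = cf g' i) -> cf (f * g) N = cf (f' * g') N.
Proof.
move=> hf hg; rewrite !cfM; apply: eq_bigr => i _.
by rewrite hf ?hg ?leq_subr // -ltnS.
Qed.

Lemma partition_le_series n :
  fps_dilate 24 (Fps (fun N => Posz (npart_le n N))) * qprod (fpsX ^+ 24) 0 n = 1.
Proof.
elim: n => [|n IH].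
  rewrite qprodnn mulr1; apply: fpsP => N; rewrite cf_dilate cfE npart_le0 cf1.
  case: dvdnP => [[k ->]|h]; first by rewrite mulnK // muln_eq0 orbF; case: eqP.
  by case: eqP => // e; case: h; exists 0%N.
rewrite qprod_recr // [X in _ * X]mulrC mulrA -[RHS]IH; congr (_ * _).
rewrite mulrC mulrBl mul1r -exprM; apply: fpsP => N; rewrite cfD cfN cf_XnM !cf_dilate !cfE.
have hn : (n < N %/ 24)%N = (24 * n.+1 <= N)%N by rewrite leq_divRL // mulnC.
case: ltnP => hN.
  by rewrite subr0; case: ifP => // hd; rewrite npart_leS hn leqNgt hN addn0.
have -> : (24 %| N - 24 * n.+1)%N = (24 %| N)%N by rewrite dvdn_subl // dvdn_mulr.
case: ifP => // hd; rewrite npart_leS hn hN [(24 * _)%N]mulnC divnBMl.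
by rewrite PoszD addrK.
Qed.

(** The substitution j = 6k + 1 identifies the two sums; the indices with |k| > n only give
    exponents of at least (6n + 5)^2, which exceeds 24 n. *)
Lemma cf_eta_pent n N : (N <= 24 * n)%N ->
  cf (theta 1 eta_char) N =
  cf (fpsX * \sum_(k <- zrange n) (-1) ^+ absz k * (fpsX ^+ 24) ^+ pent k : fps int) N.
Proof.
move=> Nn; rewrite mulr_sumr cf_sum.
pose e (k : int) : int := 6 * k + 1.
transitivity (\sum_(k <- zrange n | (absz (e k) ^ 2 == N)%N) (-1) ^+ absz k : int); last first.
  rewrite big_mkcond; apply: eq_bigr => k _.
  rewrite mulrCA -exprM -exprS.
  have -> : cf ((-1) ^+ absz k * fpsX ^+ (24 * pent k).+1) N =
      (-1) ^+ absz k * cf (fpsX ^+ (24 * pent k).+1) N :> int.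
    by rewrite -signr_odd cf_signM signr_odd.
  rewrite cf_Xn -[(24 * _).+1]addn1 pentE -/(e k) eq_sym.
  by case: eqP; rewrite ?mulr1 ?mulr0.
rewrite (@cf_theta _ 1 eta_char N (maxn N (6 * n + 1))) ?leq_maxl //.
pose hit (j : int) := (6%Z %| j - 1)%Z.
rewrite (bigID hit) /= [X in _ + X]big1 ?addr0; last first.
  move=> j /andP[_ hj]; rewrite /eta_char /hit in hj *.
  by case: ifP => [h|_]; [lia | case: ifP => // h; lia].
rewrite -big_filter -[RHS]big_filter.
rewrite (eq_big_seq (fun j : int => (-1) ^+ absz ((j - 1) %/ 6)%Z)); last first.
  move=> j; rewrite mem_filter /hit /eta_char => /andP[/andP[_ hj] _].
  by rewrite -signr_odd; case: ifP => h; [|case: ifP => h'];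
    have := divz_eq (j - 1) 6; case: (boolP (odd _)) => // ho; lia.
have -> : \sum_(k <- [seq k <- zrange n | (absz (e k) ^ 2 == N)%N]) (-1) ^+ absz k =
   \sum_(j <- map e [seq k <- zrange n | (absz (e k) ^ 2 == N)%N])
     (-1) ^+ absz ((j - 1) %/ 6)%Z :> int.
  rewrite big_map; apply: eq_bigr => k _; congr (_ ^+ absz _); rewrite /e; lia.
apply: perm_big; apply: uniq_perm; first by rewrite filter_uniq ?uniq_zrange.
  rewrite map_inj_uniq ?filter_uniq ?uniq_zrange // => a b; rewrite /e; lia.
move=> j; rewrite mem_filter mem_zrange; apply/idP/mapP.
  case/andP=> /andP[/eqP hN hj] _; exists ((j - 1) %/ 6)%Z; last by rewrite /e /hit in hj *; lia.
  rewrite mem_filter mem_zrange /=.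
  have -> : e ((j - 1) %/ 6)%Z = j by rewrite /e /hit in hj *; lia.
  rewrite mul1n in hN; apply/andP; split; first exact/eqP.
  rewrite leqNgt; apply/negP => hlt; have : (6 * n + 5 <= absz j)%N by rewrite /hit in hj; lia.
  move=> h; have := leq_mul h h; rewrite -[(absz j * _)%N]/(absz j ^ 2)%N hN; move: Nn; nia.
case=> k; rewrite mem_filter mem_zrange => /andP[/eqP hN hk] ->.
rewrite mul1n hN eqxx /= /hit /e leq_max.
by apply/andP; split; [lia | apply/orP; right; lia].
Qed.

Theorem partition_series_eta : partition_series * theta 1 eta_char = fpsX.
Proof.
apply: fpsP => N.
pose D := fps_dilate 24 (Fps (fun n => Posz (npart_le N n))).
rewrite (@cf_mul_agree _ _ D _ (fpsX * qprod (fpsX ^+ 24) 0 N)).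
- by rewrite mulrCA partition_le_series mulr1.
- move=> i iN; rewrite !cf_dilate !cfE npart_leE //.
  exact: leq_trans (leq_div _ _) iN.
move=> i iN; rewrite (@cf_eta_pent N) ?(leq_trans iN) ?leq_pmull //.
(* Up to degree [N] only the term [s = 0] of Shanks' sum counts, namely the product inverted by
   [partition_le_series]; for [s >= 1] the exponents exceed [N]. *)
rewrite -shanks_pentagonal /shanks big_ord_recl /= !mul1r mulrDr cfD.
rewrite expr0 mulr1 mulr_sumr cf_sum big1 ?addr0 // => s _.
rewrite -exprM [fpsX * _]mulrC -!mulrA -exprSr mulrA mulrC cf_XnM ifT //.
by rewrite ltnS (leq_trans iN) // /bump /=; nia.
Qed.

(** * Transcendence of eta modulo a prime *)

Lemma prime_mul_sqr_neq p (s t : nat) : prime p -> (0 < t)%N -> (p * s ^ 2 <> t ^ 2)%N.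
Proof.
move=> pp t0 e; have s0 : (0 < s)%N.
  by rewrite lt0n; apply/eqP => s0; move: e; rewrite s0 muln0 => /esym/eqP; rewrite expn_eq0; lia.
have := congr1 (logn p) e; rewrite lognM ?expn_gt0 ?s0 ?prime_gt0 // !lognX logn_prime // eqxx.
lia.
Qed.

(** With e, e' the two errors and s = k' - k, the number c = 2nt - 2pks is bounded by C. Eliminating
    k gives 4 (n^2 - e) (t^2 - p s^2) = 4ntc - c^2 - 4e t^2, quadratic in n on the left because p
    s^2 and t^2 differ, but at most linear on the right. *)
Lemma no_close_squares (p n t k k' d : int) :
  let C := 4 * p * t ^+ 2 + t ^+ 2 + 2 * d in
  1 < p -> 0 < t -> 0 <= d -> 0 <= k -> 0 <= k' ->
  (forall s : int, p * s ^+ 2 <> t ^+ 2) ->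
  4 * t * C + C ^+ 2 + 4 * d * t ^+ 2 + 4 * d + t + 1 <= n ->
  `|n ^+ 2 - p * k ^+ 2| <= d -> `|(n + t) ^+ 2 - p * k' ^+ 2| <= d -> False.
Proof.
move=> C p1 t0 d0 k0 k'0 irr nC; rewrite !ler_norml => /andP[e1 e2] /andP[f1 f2].
have [s sE] : exists s, k' = k + s by exists (k' - k); ring.
have [e eE] : exists e, e = n ^+ 2 - p * k ^+ 2 by eexists.
have [e' e'E] : exists e', e' = (n + t) ^+ 2 - p * k' ^+ 2 by eexists.
rewrite -eE in e1 e2; rewrite -e'E in f1 f2.
have CE : C = 4 * p * t ^+ 2 + t ^+ 2 + 2 * d by [].
clearbody C.
have t2 : 0 < t ^+ 2 by rewrite exprn_gt0.
have pt2 : 0 < p * t ^+ 2 by rewrite mulr_gt0 //; lia.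
have C0 : 0 <= C by rewrite CE; clear -pt2 t2 d0; lia.
have tC : 0 <= t * C by rewrite mulr_ge0 //; lia.
have dt : 0 <= d * t ^+ 2 by rewrite mulr_ge0 //; lia.
have CC : 0 <= C ^+ 2 by rewrite sqr_ge0.
have nt : t <= n by clear -nC tC CC dt d0 t0; lia.
have n1 : 1 <= n by clear -nC tC CC dt d0 t0; lia.
have n0 : 0 <= n by lia.
have p0 : 0 <= p by lia.
have tge0 : 0 <= t by lia.
have nd : 4 * d <= n by clear -nC tC CC dt d0 t0; lia.
have nn : n <= n ^+ 2 by rewrite expr2 ler_peMr //; lia.
have mono (x : int) : 0 <= x -> x <= n * x by move=> x0; rewrite ler_peMl.
(* As p >= 2, (p k1)^2 = p (m^2 - a1) is at least 2 (m^2 - a1), hence at least n^2. *)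
have small (m k1 a1 : int) : n <= m -> a1 <= d -> 0 <= k1 ->
    a1 = m ^+ 2 - p * k1 ^+ 2 -> n <= p * k1.
  move=> nm ed k10 he; rewrite leNgt; apply/negP => h.
  have h2 : (p * k1) ^+ 2 < n ^+ 2.
    by rewrite ltr_pXn2r ?nnegrE // mulr_ge0.
  have m2 : n ^+ 2 <= m ^+ 2 by rewrite ler_pXn2r ?nnegrE // (le_trans n0).
  have e3 : (p * k1) ^+ 2 = p * (m ^+ 2 - a1) by rewrite he; ring.
  have : 2 * (m ^+ 2 - a1) <= p * (m ^+ 2 - a1) by rewrite ler_wpM2r //; last by clear -ed m2 nn nd d0 n1; lia.
  by rewrite -e3; clear -ed m2 nn nd d0 n1 h2; lia.
have kn : n <= p * k by apply: (@small n k e).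
have kn' : n <= p * k' by apply: (@small (n + t) k' e'); rewrite // lerDl ltW.
have hs : s * (p * k + p * k') = 2 * n * t + t ^+ 2 + e - e'.
  by rewrite eE e'E sE; ring.
have ntn : n <= n * t by rewrite ler_peMr //; lia.
have tnt : t ^+ 2 <= n * t by rewrite expr2 ler_wpM2r //; lia.
have s0 : 0 < s.
  rewrite ltNge; apply/negP => h.
  have : s * (p * k + p * k') <= 0 by rewrite mulr_le0_ge0 // addr_ge0 // mulr_ge0.
  by rewrite hs; clear -e1 e2 f1 f2 ntn nd n1 t2 d0; lia.
have s2 : s <= 2 * t.
  rewrite leNgt; apply/negP => h.
  have : (2 * t + 1) * (2 * n) <= s * (p * k + p * k').
    apply: ler_pM; clear -h n0 tge0 kn kn'; lia.
  by rewrite hs; clear -e1 e2 f1 f2 tnt nd n1 t2 d0; lia.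
have ss : p * s ^+ 2 <= 4 * (p * t ^+ 2).
  have -> : 4 * (p * t ^+ 2) = p * (2 * t) ^+ 2 by ring.
  by rewrite ler_wpM2l // ler_pXn2r ?nnegrE // ?mulr_ge0 // ltW.
have ps : 0 <= p * s ^+ 2 by rewrite mulr_ge0 ?sqr_ge0.
have [c cE] : exists c, c = p * s ^+ 2 - t ^+ 2 + e' - e by eexists.
have /andP[c1 c2] : - C <= c <= C.
  by rewrite cE CE; clear -ss ps t2 e1 e2 f1 f2 d0 pt2; apply/andP; split; lia.
have hc : 2 * n * t - 2 * p * k * s = c by rewrite cE e'E eE sE; ring.
have [z zE] : exists z, z = t ^+ 2 - p * s ^+ 2 by eexists.
have z0 : z != 0 by rewrite zE subr_eq0 eq_sym; apply/eqP/irr.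
have hz : 4 * (n ^+ 2 - e) * z = 4 * (n * t) * c - c ^+ 2 - 4 * (e * t ^+ 2).
  by rewrite -hc zE eE; ring.
have ne : 0 <= n ^+ 2 - e by clear -nn nd e2 d0 n1; lia.
have L : 4 * (n ^+ 2 - d) <= `|4 * (n ^+ 2 - e) * z|.
  have z1 : 1 <= `|z| by rewrite -gtz0_ge1 normr_gt0.
  have q0 : 0 <= 4 * (n ^+ 2 - e) by clear -ne n0; lia.
  rewrite normrM ger0_norm //; apply: le_trans (ler_peMr q0 z1).
  by clear -e2; lia.
have U : `|4 * (n * t) * c - c ^+ 2 - 4 * (e * t ^+ 2)| <=
         4 * (n * t) * C + C ^+ 2 + 4 * (d * t ^+ 2).
  have nt0 : 0 <= 4 * (n * t) by rewrite !mulr_ge0.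
  have u1 := ler_wpM2l nt0 c2; have u2 := ler_wpM2l nt0 c1.
  have cc : c ^+ 2 <= C ^+ 2.
    by rewrite -[c ^+ 2]real_normK ?num_real // ler_pXn2r ?nnegrE // ler_norml c1.
  have c0 := sqr_ge0 c.
  have u3 := ler_wpM2r (ltW t2) e1; have u4 := ler_wpM2r (ltW t2) e2.
  by rewrite ler_norml; clear -u1 u2 cc c0 u3 u4 CC; apply/andP; split; lia.
rewrite hz in L; have := le_trans L U.
have b1 := ler_wpM2l n0 nC; rewrite -expr2 in b1.
have b2 := mono _ CC; have b3 := mono _ dt; have b4 := mono _ d0; have b5 := mono _ tge0.
by clear -b1 b2 b3 b4 b5 n1 CC dt tge0 CE; lia.
Qed.

Section Transcendence.
Variables (p : nat) (pp : prime p).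
Local Notation F := 'F_p.

Definition eta_mod (r : nat) : fps F := theta r (fun n => (eta_char n)%:~R).

Lemma Fp_frobenius (c : F) : c ^+ p = c.
Proof. by have := expf_card c; rewrite card_Fp. Qed.

Lemma theta_frobenius r (w : int -> F) : (0 < r)%N ->
  theta r w ^+ p = theta (p * r) w.
Proof.
move=> r0; have p0 := prime_gt0 pp.
rewrite (fps_frobenius (pchar_Fp pp) Fp_frobenius); apply: fpsP => N.
rewrite cf_dilate [RHS]cfE; case: dvdnP => [[q ->]|h].
  rewrite mulnK // (@cf_theta _ r w q (q * p)) ?leq_pmulr //.
  by apply: eq_bigl => n; rewrite -[in RHS]mulnA [in RHS](mulnC q) eqn_pmul2l.
apply/esym/big1 => n /eqP hn; case: h; exists (r * absz n ^ 2)%N.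
by rewrite -hn -mulnA mulnC.
Qed.

Lemma eta_mod_expp i : eta_mod 1 ^+ (p ^ i) = eta_mod (p ^ i).
Proof.
elim: i => [|i IH]; first by rewrite expr1.
by rewrite expnSr exprM IH theta_frobenius ?expn_gt0 ?prime_gt0 // mulnC.
Qed.

(* Modulo [B], the powers [Y ^ e i] live in a space of dimension [deg B]. *)
Lemma lacunary_multiple (B : {poly {poly F}}) (y : fps F) (e : nat -> nat) :
  B != 0 -> (map_poly (@fps_poly F) B).[y] = 0 ->
  exists a : 'I_(size B) -> {poly F}, (exists i, a i != 0) /\
    \sum_i fps_poly (a i) * y ^+ (e i) = 0.
Proof.
move=> B0 hy.
pose rem (i : 'I_(size B)) := ('X^(e i) %% B).
pose quo (i : 'I_(size B)) := ('X^(e i) %/ B).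
(* The coefficients form only a ring, so division by [B] is pseudo-division and costs this power of
   the leading coefficient. *)
pose lc (i : 'I_(size B)) := lead_coef B ^+ scalp 'X^(e i) B.
have szB : (0 < size B)%N by rewrite size_poly_gt0.
have [|d [[i0 d0] hd]] := @linear_dependence {poly F} 'I_(size B) 'I_(size B).-1
  (fun i k => (rem i)`_k).
  by rewrite !card_ord prednK.
exists (fun i => d i * lc i); split.
  by exists i0; rewrite mulf_neq0 ?expf_neq0 ?lead_coef_eq0.
pose ev (P : {poly {poly F}}) := (map_poly (@fps_poly F) P).[y].
have ev_sum (f : 'I_(size B) -> {poly {poly F}}) : ev (\sum_i f i) = \sum_i ev (f i).
  by rewrite /ev rmorph_sum horner_sum.
transitivity (ev (\sum_i (d i) *: (lc i *: 'X^(e i)))).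
  rewrite ev_sum; apply: eq_bigr => i _.
  by rewrite /ev scalerA map_polyZ map_polyXn hornerZ hornerXn.
rewrite (eq_bigr (fun i => d i *: (quo i) * B + d i *: rem i)); last first.
  by move=> i _; rewrite Pdiv.Idomain.divp_eq scalerDr scalerAl.
rewrite big_split /= {1}/ev rmorphD hornerD -!/(ev _) -mulr_suml.
rewrite {1}/ev rmorphM hornerM hy mulr0 add0r.
suff -> : \sum_i d i *: rem i = 0 by rewrite /ev rmorph0 horner0.
apply/polyP => k; rewrite coef0 coef_sum.
case: (ltnP k (size B).-1) => hk.
  rewrite -[RHS](hd (Ordinal hk)); apply: eq_bigr => i _; by rewrite coefZ.
apply: big1 => i _; rewrite coefZ nth_default ?mulr0 //.
apply: leq_trans hk; rewrite -ltnS prednK //.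
by rewrite Pdiv.Idomain.ltn_modp.
Qed.

Lemma sum_neq0 (V : nmodType) (I : finType) (P : pred I) (G : I -> V) :
  \sum_(i | P i) G i != 0 -> exists2 i, P i & G i != 0.
Proof.
move=> h; case: (pickP (fun i => P i && (G i != 0))) => [i /andP[]|h0]; first by exists i.
case/negP: h; apply/eqP/big1 => i Pi; have := h0 i; rewrite Pi => /negbFE/eqP //.
Qed.

Lemma cf_eta_neq0 r N : cf (eta_mod r) N != 0 -> exists n, N = (r * n ^ 2)%N.
Proof.
rewrite cfE => h; case: (pickP (fun n : 'I_N.+1 => (r * n ^ 2)%N == N)) => [n /eqP|h0].
  by exists n.
case/negP: h; apply/eqP; rewrite big_seq_cond; apply: big1 => z /andP[].
rewrite mem_zrange -ltnS => hz /eqP e.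
by have := h0 (Ordinal hz); rewrite /= e eqxx.
Qed.

Lemma cf_eta_sq r n : (0 < r)%N -> (n %% 12 = 1)%N -> cf (eta_mod r) (r * n ^ 2) = 1.
Proof.
move=> r0 n1; rewrite cfE.
have nz : Posz n \in zrange (r * n ^ 2) by rewrite mem_zrange /=; nia.
rewrite big_mkcond (bigD1_seq (Posz n)) ?uniq_zrange //= eqxx.
rewrite big1 ?addr0 => [|z hz].
  by rewrite /eta_char ifT //; lia.
case: eqP => // e; have {}e : absz z = n.
  by apply/eqP; rewrite -eqn_sqr -(eqn_pmul2l r0); apply/eqP.
have -> : z = - Posz n by lia.
rewrite /eta_char; case: ifP => [/dvdzP[q hq]|_]; first by have := divn_eq n 12; lia.
by case: ifP => [/dvdzP[q hq]|//]; have := divn_eq n 12; lia.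
Qed.

Lemma cf_fps_polyM (a : {poly F}) r N :
  cf (fps_poly a * eta_mod r) N != 0 ->
  exists j n, (j < size a)%N /\ N = (r * n ^ 2 + j)%N.
Proof.
rewrite cfM => /sum_neq0[j _]; rewrite mulf_eq0 negb_or => /andP[ha /cf_eta_neq0[n hn]].
exists (val j), n; split; last by rewrite -hn subnK // -ltnS ltn_ord.
by rewrite ltnNge; apply: contra ha => h; rewrite cfE nth_default.
Qed.

Theorem eta_transcendental (B : {poly {poly F}}) :
  B != 0 -> (map_poly (@fps_poly F) B).[eta_mod 1] != 0.
Proof.
move=> B0; apply/eqP => hB.
have [a [[i0 hi0] ha]] := lacunary_multiple (fun i => p ^ i)%N B0 hB.
have p0 := prime_gt0 pp; have p1 := prime_gt1 pp.
(* [r] is the least index with a nonzero coefficient; the relation is read at x^(p^r n^2 + u), with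
   u the degree of [a r]. *)
case: (@arg_minnP _ i0 (fun i => a i != 0) val hi0) => r ar rmin.
pose u := (size (a r)).-1.
have au : (a r)`_u != 0 by rewrite -[_`_u]/(lead_coef _) lead_coef_eq0.
pose D := (\sum_i size (a i))%N.
have aD i : (size (a i) <= D)%N by rewrite /D (bigD1 i) //= leq_addr.
have uD : (u < D)%N by apply: leq_trans (aD r); rewrite prednK ?size_poly_gt0.
have pr0 : (0 < p ^ r)%N by rewrite expn_gt0 p0.
have far n n' x : (D < n)%N -> (x <= D)%N -> (n <> n')%N -> (n ^ 2 <= n' ^ 2 + x)%N ->
    (n' ^ 2 <= n ^ 2 + x)%N -> False.
  move=> Dn xD; rewrite -!mulnn => ne h1 h2.
  case: (ltngtP n n') => // lt; [have := leq_mul lt lt | have := leq_mul lt lt]; nia.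
(* The term of index [r] contributes its leading coefficient alone, since other squares are too far
   from n^2. A later index i must cancel it, which puts p^(i-r) n'^2 within [D] of n^2. *)
have near n : (D < n)%N -> (n %% 12 = 1)%N -> (n %% p = 1)%N -> exists k : nat,
    (n ^ 2 <= p * k ^ 2 + D)%N /\ (p * k ^ 2 <= n ^ 2 + D)%N.
  move=> Dn n12 np.
  have ha' : \sum_i fps_poly (a i) * eta_mod (p ^ i) = 0.
    by rewrite -[RHS]ha; apply: eq_bigr => i _; rewrite eta_mod_expp.
  have : cf (\sum_i fps_poly (a i) * eta_mod (p ^ i)) (p ^ r * n ^ 2 + u) = 0.
    by rewrite ha' cf0.
  rewrite cf_sum (bigD1 r) //= => hsum.
  have hr : cf (fps_poly (a r) * eta_mod (p ^ r)) (p ^ r * n ^ 2 + u) = (a r)`_u.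
    have hu : (u < (p ^ r * n ^ 2 + u).+1)%N by rewrite ltnS leq_addl.
    rewrite cfM (bigD1 (Ordinal hu)) //= addnK cf_eta_sq // mulr1.
    rewrite big1 ?addr0 // => j; rewrite -val_eqE /= => ju; apply/eqP/negPn/negP.
    rewrite mulf_eq0 negb_or => /andP[haj /cf_eta_neq0[n' hn']].
    have jD : (j < D)%N.
      by apply: leq_trans (aD r); rewrite ltnNge; apply: contra haj => h; rewrite cfE nth_default.
    have hj := ltn_ord j.
    have e : (p ^ r * n' ^ 2 + j = p ^ r * n ^ 2 + u)%N by rewrite -hn' subnK // -ltnS.
    move: (nat_of_ord j) ju e jD => j0 ju0 e jD.
    apply: (@far n n' D) => // [nn'||]; first by move: e; rewrite -nn' => /addnI/eqP; apply/negP.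
      rewrite -(leq_pmul2l pr0) mulnDr; move: (leq_pmull D pr0) e uD jD.
      by move: (p ^ r * n ^ 2)%N (p ^ r * n' ^ 2)%N (p ^ r * D)%N; clear; lia.
    rewrite -(leq_pmul2l pr0) mulnDr; move: (leq_pmull D pr0) e uD jD.
    by move: (p ^ r * n ^ 2)%N (p ^ r * n' ^ 2)%N (p ^ r * D)%N; clear; lia.
  have : \sum_(i | i != r) cf (fps_poly (a i) * eta_mod (p ^ i)) (p ^ r * n ^ 2 + u) != 0.
    apply/eqP => h0; move: hsum; rewrite h0 addr0 => h; move: au.
    by rewrite -hr h eqxx.
  case/sum_neq0 => i ir /cf_fps_polyM[j [n' [hj hN]]].
  have ri : (r < i)%N.
    rewrite ltn_neqAle eq_sym val_eqE ir rmin //; apply/eqP => ai.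
    by move: hj; rewrite ai size_poly0.
  have jD : (j < D)%N := leq_trans hj (aD i).
  pose h := (i - r)%N; have hi : (p ^ i = p ^ r * p ^ h)%N by rewrite -expnD subnKC // ltnW.
  rewrite hi -mulnA in hN.
  have b1 : (n ^ 2 <= p ^ h * n' ^ 2 + D)%N.
    rewrite -(leq_pmul2l pr0) mulnDr; move: (leq_pmull D pr0) hN uD jD.
    by move: (p ^ r * n ^ 2)%N (p ^ r * (p ^ h * n' ^ 2))%N (p ^ r * D)%N; clear; lia.
  have b2 : (p ^ h * n' ^ 2 <= n ^ 2 + D)%N.
    rewrite -(leq_pmul2l pr0) mulnDr; move: (leq_pmull D pr0) hN uD jD.
    by move: (p ^ r * n ^ 2)%N (p ^ r * (p ^ h * n' ^ 2))%N (p ^ r * D)%N; clear; lia.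
  (* For odd [h] the nearby number is [p] times a square, as wanted. For even [h] it is a square,
     hence equal to n^2, and then p divides n, against n = 1 mod p. *)
  have hh := odd_double_half h; case: (boolP (odd h)) => ho; rewrite ?ho ?(negbTE ho) in hh.
    exists (p ^ h./2 * n')%N; rewrite expnMn -expnM muln2 mulnA -expnS -[(h./2.*2).+1]add1n.
    by rewrite hh.
  have hE : (p ^ h * n' ^ 2 = (p ^ h./2 * n') ^ 2)%N.
    by rewrite expnMn -expnM muln2 -[h in LHS]hh add0n.
  rewrite hE in b1 b2; case: (@far n (p ^ h./2 * n')%N D) => // nE.
  have h0 : (0 < h)%N by rewrite subn_gt0.
  have h2 : (0 < h./2)%N by clear -hh h0; lia.
  by move: np; rewrite nE -(prednK h2) expnS -mulnA mulnC modnMl.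
(* A shift by 12 p preserves both congruences of [near], which thus applies to [n] and [n + t]; [L]
   is the threshold of [no_close_squares] for [d = D]. *)
pose t := (12 * p)%N.
pose C := 4 * Posz p * (Posz t) ^+ 2 + (Posz t) ^+ 2 + 2 * Posz D.
pose L := 4 * Posz t * C + C ^+ 2 + 4 * Posz D * Posz t ^+ 2 + 4 * Posz D + Posz t + 1.
pose n := (t * (absz L + D).+1 + 1)%N.
have t0 : (0 < t)%N by rewrite muln_gt0.
have nmod q : (1 < q)%N -> (q %| t)%N -> forall c, ((t * c + 1) %% q = 1)%N.
  by move=> q1 qt c; rewrite -modnDml -modnMml (eqP qt) mul0n mod0n modn_small.
have nt : (n + t = t * (absz L + D).+2 + 1)%N by rewrite /n mulnS; lia.
have nL : (absz L + D < n)%N.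
  by rewrite /n addn1 ltnS; apply: leq_trans (leq_pmull _ t0).
have [k [k1 k2]] : exists k : nat, (n ^ 2 <= p * k ^ 2 + D)%N /\ (p * k ^ 2 <= n ^ 2 + D)%N.
  apply: near; first by lia.
    by apply: nmod; rewrite // dvdn_mulr.
  by apply: nmod; rewrite // dvdn_mull.
have [k' [k'1 k'2]] : exists k : nat,
    ((n + t) ^ 2 <= p * k ^ 2 + D)%N /\ (p * k ^ 2 <= (n + t) ^ 2 + D)%N.
  apply: near; first by lia.
    by rewrite nt; apply: nmod; rewrite // dvdn_mulr.
  by rewrite nt; apply: nmod; rewrite // dvdn_mull.
have dist (x y : nat) : (x ^ 2 <= p * y ^ 2 + D)%N -> (p * y ^ 2 <= x ^ 2 + D)%N ->
    `|Posz x ^+ 2 - Posz p * Posz y ^+ 2| <= Posz D.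
  rewrite -!mulnn !expr2 -!PoszM ler_norml => h1 h2.
  by move: (x * x)%N (p * (y * y))%N h1 h2 => A1 A2; clear; lia.
apply: (@no_close_squares (Posz p) (Posz n) (Posz t) (Posz k) (Posz k') (Posz D)) => //.
- move=> s e; apply: (@prime_mul_sqr_neq p (absz s) t) => //.
  by apply/eqP; rewrite -eqz_nat PoszM absz_sqE -expr2 e expr2 -PoszM mulnn.
- by move: nL; rewrite -/C -/L; clear; lia.
- exact: dist.
- by rewrite -PoszD; apply: dist.
Qed.
End Transcendence.

(** * Sections of the partition series *)

Lemma primitive_family (I : finType) (d : I -> int) (p : nat) : prime p ->
  (exists i, d i != 0) ->
  exists (c : int) (d' : I -> int), [/\ c != 0, exists i, ~~ (Posz p %| d' i)%Z &
    forall i, d i = c * d' i].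
Proof.
move=> pp [i0]; have [n] := ubnP (absz (d i0)); elim: n d => // n IH d hn h0.
case: (boolP [forall i, (Posz p %| d i)%Z]) => [/forallP hd|/forallPn[i hi]]; last first.
  by exists 1, d; split=> [//||i']; [exists i | rewrite mul1r].
have e i : d i = (d i %/ Posz p)%Z * Posz p by rewrite divzK.
have p1 := prime_gt1 pp.
have h0' : (d i0 %/ Posz p)%Z != 0 by apply: contra h0 => /eqP h; rewrite e h mul0r.
have hlt : (absz (d i0 %/ Posz p)%Z < n)%N.
  move: hn; rewrite {1}(e i0) abszM ltnS /=; apply: leq_trans.
  by rewrite -[X in (X < _)%N]muln1 ltn_pmul2l // absz_gt0.
have [c [d' [c0 hd' hc]]] := IH (fun i => (d i %/ Posz p)%Z) hlt h0'.
exists (c * Posz p), d'; split=> // [|i].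
  by rewrite mulf_neq0 // eqz_nat -lt0n prime_gt0.
by rewrite e hc mulrAC.
Qed.

Lemma fps_int_cancel (c : int) (f : fps int) : c != 0 -> c%:~R * f = 0 -> f = 0.
Proof.
move=> c0 h; apply: fpsP => n; apply/eqP; rewrite cf0 -(mulrI_eq0 _ (mulfI c0)).
by rewrite -cf_CM fpsC_int h cf0.
Qed.

Lemma cf_X (R : comNzRingType) n : cf (fpsX : fps R) n = (n == 1)%N%:R.
Proof. by rewrite -[fpsX]expr1 cf_Xn. Qed.

Section Homogeneous.
Variables (mu : nat) (mu_gt0 : (0 < mu)%N).

Lemma hom_det n (B : 'M[fps int]_n) : (forall i j, hom mu 1 (B i j)) -> hom mu n (\det B).
Proof.
move=> h; apply: hom_sum => // s _.
rewrite -(rmorph_sign (@intmul (fps int) 1)); apply: homZ => //.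
by apply: hom_prod1 => // i.
Qed.
End Homogeneous.

Section Sections.
Variables (Q : nat) (Q_gt0 : (0 < Q)%N) (w : int -> int) (P : fps int).
Local Notation f := (theta 1 w).

Definition sec_char (i j : nat) (n : int) : int :=
  if (absz n ^ 2 + j == 1 + i %[mod Q])%N then w n else 0.

(** Entry (i, j) is the part of [f] with exponents 1 + i - j modulo [Q], and entry (j, k) of
    [sec_series] the part of [P] with exponents j - k. Their product sorts [f * P] by exponents 1 +
    i - k; the offset 1 puts x on the diagonal when [f * P = fpsX]. *)
Definition sec_theta : 'M[fps int]_Q := \matrix_(i, j) theta 1 (sec_char i j).
Definition sec_series : 'M[fps int]_Q :=
  \matrix_(j, k) Fps (fun N => if (N + k == j %[mod Q])%N then cf P N else 0).

Lemma cf_sec_theta i j N :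
  cf (sec_theta i j) N = if (N + j == 1 + i %[mod Q])%N then cf f N else 0.
Proof.
rewrite mxE !cfE; case: ifP => h.
  by apply: eq_bigr => n /eqP hn; rewrite /sec_char -[(_ ^ 2)%N]mul1n hn h.
by apply: big1 => n /eqP hn; rewrite /sec_char -[(_ ^ 2)%N]mul1n hn h.
Qed.

Lemma sec_mul : f * P = fpsX -> sec_theta *m sec_series = fpsX%:M.
Proof.
move=> hfP; apply/matrixP => i k; rewrite !mxE; apply: fpsP => N.
have -> : cf (fpsX *+ (i == k)) N = (if (N + k == 1 + i %[mod Q])%N then cf (f * P) N else 0).
  rewrite hfP cf_X.
  case: (N =P 1%N) => [->|hN]; last first.
    rewrite if_same; case: (i == k); rewrite ?mulr0n ?cf0 // mulr1n cf_X.
    by case: eqP.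
  rewrite eqn_modDl !modn_small // val_eqE eq_sym.
  by case: (k == i); rewrite ?mulr1n ?cf_X ?mulr0n.
rewrite cf_sum cfM.
transitivity (\sum_(a < N.+1) \sum_j cf (sec_theta i j) a * cf (sec_series j k) (N - a)).
  by rewrite [RHS]exchange_big; apply: eq_bigr => j _; rewrite cfM.
have -> : (if (N + k == 1 + i %[mod Q])%N then \sum_(a < N.+1) cf f a * cf P (N - a) else 0)
  = \sum_(a < N.+1) if (N + k == 1 + i %[mod Q])%N then cf f a * cf P (N - a) else 0.
  by case: ifP => // _; rewrite big1.
apply: eq_bigr => a _; pose j0 := Ordinal (ltn_pmod (N - a + k) Q_gt0).
have cfs j : cf (sec_series j k) (N - a) = if (N - a + k == j %[mod Q])%N then cf P (N - a) else 0.
  by rewrite mxE cfE.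
rewrite (bigD1 j0) //= big1 ?addr0 => [|j]; last first.
  rewrite -val_eqE /= cfs => hj; case: ifP => h; last by rewrite mulr0.
  by case/negP: hj; rewrite (eqP h) modn_small.
rewrite cf_sec_theta cfs /= modn_mod eqxx modnDmr addnA subnKC; last by rewrite -ltnS.
by case: ifP; rewrite ?mul0r.
Qed.

Lemma sec_det : f * P = fpsX -> \det sec_theta * \det sec_series = fpsX ^+ Q.
Proof. by move=> h; rewrite -det_mulmx sec_mul // det_scalar. Qed.

(** Cramer's rule: a section of [P] is x times a cofactor over the determinant, a quotient of forms
    in theta series. *)
Lemma sec_cofactor i j : f * P = fpsX ->
  fpsX * (\adj sec_theta) i j = \det sec_theta * sec_series i j.
Proof.
move=> h; have := congr1 (fun B => (\adj sec_theta *m B) i j) (sec_mul h).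
by rewrite mulmxA mul_adj_mx mul_scalar_mx mul_mx_scalar !mxE.
Qed.
End Sections.

Lemma dvdz_period (a : int) (d m n : int) : (d %| m)%Z ->
  (d %| n + m - a)%Z = (d %| n - a)%Z.
Proof.
move=> /dvdzP[k ->]; apply/dvdzP/dvdzP => -[x hx].
  by exists (x - k); rewrite mulrBl -hx; ring.
by exists (x + k); rewrite mulrDl -hx; ring.
Qed.

Lemma eta_char_period m n : (12 %| m)%N -> eta_char (n + Posz m) = eta_char n.
Proof. by move=> h; rewrite /eta_char !dvdz_period. Qed.

Lemma sqr_period Q m (n : int) : (Q %| m)%N ->
  (absz (n + Posz m)%R ^ 2 = absz n ^ 2 %[mod Q])%N.
Proof.
move=> /dvdnP[k ->].
have : (Posz (absz (n + Posz (k * Q)%N)%R ^ 2) = Posz (absz n ^ 2) %[mod Posz Q])%Z.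
  rewrite !absz_sqE PoszM.
  have -> : (n + Posz k * Posz Q) * (n + Posz k * Posz Q) =
    (Posz k * (2 * n + Posz k * Posz Q)) * Posz Q + n * n by ring.
  exact: modzMDl.
by rewrite !modz_nat => -[].
Qed.

Lemma sec_char_period Q i j m n : (12 %| m)%N -> (Q %| m)%N ->
  sec_char Q eta_char i j (n + Posz m) = sec_char Q eta_char i j n.
Proof.
move=> h12 hQ; rewrite /sec_char eta_char_period //.
by rewrite -modnDml (sqr_period _ hQ) modnDml.
Qed.

Definition dilated_char (p : nat) (n : int) : int :=
  if (Posz p %| n)%Z then eta_char (n %/ Posz p)%Z else 0.

Lemma theta_dilated p : (0 < p)%N -> theta 1 (dilated_char p) = theta (p ^ 2) eta_char.
Proof.
move=> p0; apply: fpsP => N; rewrite !cfE.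
have ur := uniq_zrange N; have mr := mem_zrange N; move: (zrange N) ur mr => r ur mr.
rewrite [RHS](eq_bigr (fun n => dilated_char p (n * Posz p))); last first.
  by move=> n _; rewrite /dilated_char dvdz_mull // mulzK //; lia.
rewrite -[RHS]big_filter -[RHS](big_map (fun n => n * Posz p) xpredT (dilated_char p)).
rewrite (bigID (fun n => (Posz p %| n)%Z)) /= [X in _ + X]big1 ?addr0; last first.
  by move=> n /andP[_ h]; rewrite /dilated_char (negbTE h).
rewrite -big_filter; apply: perm_big; apply: uniq_perm.
- by rewrite filter_uniq.
- rewrite map_inj_uniq ?filter_uniq // => a b; nia.
move=> n; rewrite mem_filter mr; apply/idP/mapP.
  case/andP=> /andP[/eqP hN /dvdzP[k hk]] hn; exists k => //.
  rewrite mem_filter mr; move: hN hn; rewrite hk abszM /= mul1n expnMn mulnC => ->.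
  by rewrite eqxx; apply: leq_trans; rewrite leq_pmulr.
case=> k; rewrite mem_filter mr => /andP[/eqP hN hk] ->.
have hN' : (absz (k * Posz p)%R ^ 2 = N)%N by rewrite abszM expnMn mulnC.
rewrite mul1n hN' eqxx dvdz_mull //=.
by apply: (@sq_leq 1); rewrite // mul1n hN'.
Qed.

Lemma dilated_char_period p m n : (0 < p)%N -> (12 * p %| m)%N ->
  dilated_char p (n + Posz m) = dilated_char p n.
Proof.
move=> p0 /dvdnP[k ->]; rewrite /dilated_char.
have e : n + Posz (k * (12 * p))%N = n + Posz (12 * k)%N * Posz p.
  by rewrite !PoszM; ring.
have := @dvdz_period 0 (Posz p) (Posz (12 * k)%N * Posz p) n (dvdz_mull _ (dvdzz _)).
rewrite !subr0 e => ->; case: ifP => // /dvdzP[q ->].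
by rewrite -mulrDl !mulzK ?eta_char_period ?dvdn_mulr //; lia.
Qed.

(** * Isolated values of the partition function *)

Lemma map_theta (S : comNzRingType) (phi : {rmorphism int -> S}) r w :
  map_fps phi (theta r w) = theta r (phi \o w).
Proof. by apply: fpsP => N; rewrite !cfE rmorph_sum. Qed.

Lemma intr_Fp_eq0 p (z : int) : prime p -> ((z%:~R : 'F_p) == 0) = (Posz p %| z)%Z.
Proof.
move=> pp; have h n : ((n%:R : 'F_p) == 0) = (p %| n)%N.
  by rewrite (dvdn_pcharf (pchar_Fp pp)).
by case: z => n; rewrite ?NegzE ?mulrNz ?oppr_eq0 -pmulrn h // dvdzE.
Qed.

(** The exponent is D + (24 n - 1) i, and 24 n - 1 is never zero. *)
Lemma shifted_exponent_inj D n i j : (i <= D)%N -> (j <= D)%N ->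
  (D - i + 24 * n * i = D - j + 24 * n * j)%N -> i = j.
Proof.
wlog ij : i j / (i <= j)%N.
  by move=> W iD jD e; case: (leqP i j) => h; [|apply: esym]; apply: W => //; exact: ltnW.
move=> iD jD; rewrite -(subnKC ij); move: (j - i)%N (subnKC ij) => k kj.
by case: n => [|n]; rewrite ?mulnDr ?mulnS ?mulnDl; lia.
Qed.

Lemma scaled_exponent_inj D r i j : (1 < r)%N -> (i <= D)%N -> (j <= D)%N ->
  (r * i + (D - i) = r * j + (D - j))%N -> i = j.
Proof.
case: r => // -[//|r] _ iD jD e; apply/eqP; rewrite -(eqn_pmul2l (ltn0Sn r)).
by apply/eqP; move: e; rewrite !mulSn; lia.
Qed.

Section Core.
Variables (p e A n0 : nat).
Hypotheses (pp : prime p) (n0A : (n0 < A)%N).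
Hypothesis hdvd : forall j, (0 < j)%N -> (p ^ e %| npart (n0 + A * j))%N.
Hypothesis hndvd : ~~ (p ^ e %| npart n0)%N.

Local Notation Q := (24 * A)%N.
(** Chosen so that 2 mu = 24 A p is a common period of [eta_char], of its sections modulo [Q] and of
    [dilated_char p]. *)
Local Notation mu := (12 * A * p)%N.
Local Notation eta := (theta 1 eta_char).
Local Notation eta2 := (theta 1 (dilated_char p)).
Local Notation v := (logn p (npart n0)).

Fact A_gt0 : (0 < A)%N. Proof. exact: leq_ltn_trans (leq0n n0) n0A. Qed.
Fact Q_gt0 : (0 < Q)%N. Proof. by rewrite muln_gt0 A_gt0. Qed.
Fact core_mu_gt0 : (0 < mu)%N. Proof. by rewrite !muln_gt0 A_gt0 (prime_gt0 pp). Qed.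

Fact npart_n0_gt0 : (0 < npart n0)%N.
Proof. by rewrite lt0n; apply: contra hndvd => /eqP ->; exact: dvdn0. Qed.

Fact v_lt_e : (v < e)%N.
Proof. by rewrite ltnNge -pfactor_dvdn //; exact: npart_n0_gt0. Qed.

Definition idx0 : 'I_Q := Ordinal Q_gt0.
Fact idx_proof : (24 * n0 < Q)%N. Proof. by rewrite ltn_pmul2l. Qed.
Definition idx1 : 'I_Q := Ordinal idx_proof.

Definition Mdet : fps int := \det (sec_theta Q eta_char).
Definition Pdet : fps int := \det (sec_series Q partition_series).
Definition Cof : fps int := (\adj (sec_theta Q eta_char)) idx1 idx0.
Definition Psec : fps int := sec_series Q partition_series idx1 idx0.

Fact eta_partition : eta * partition_series = fpsX.
Proof. by rewrite mulrC partition_series_eta. Qed.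

Fact Mdet_Pdet : Mdet * Pdet = fpsX ^+ Q.
Proof. exact: (sec_det Q_gt0 eta_partition). Qed.

Fact fpsX_Cof : fpsX * Cof = Mdet * Psec.
Proof. exact: (sec_cofactor Q_gt0 _ _ eta_partition). Qed.

Lemma cf_Psec N : cf Psec N =
  if (24 %| N)%N && (N %/ 24 == n0 %[mod A])%N then Posz (npart (N %/ 24)) else 0.
Proof.
rewrite /Psec mxE cfE cf_dilate cfE /= addn0.
case: (boolP (24 %| N)%N) => [/dvdnP[k ->]|h]; last by rewrite if_same.
by rewrite mulnK // mulnC -!muln_modr eqn_pmul2l.
Qed.

(** The exponents of [Psec] are the 24 n with n = n0 mod A, and n >= n0 since n0 < A. All values
    with n > n0 are divisible by p^e with e > v, so after division by p^v only the term of n0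
    survives modulo [p]. *)
Lemma Psec_split : exists P' : fps int, exists u : 'F_p,
  [/\ Psec = ((p ^ v)%N%:Z)%:~R * P', u != 0 &
      map_fps (@intmul 'F_p 1) P' = fpsC u * fpsX ^+ (24 * n0)].
Proof.
have pv : (p ^ v != 0)%N by rewrite -lt0n expn_gt0 prime_gt0.
have main N : (p ^ v %| absz (cf Psec N))%N /\
   (N != 24 * n0 -> p ^ e %| absz (cf Psec N))%N.
  rewrite cf_Psec; case: andP => [[/dvdnP[k ->] hk]|_]; last by rewrite /= !dvdn0.
  rewrite mulnK // in hk *; rewrite /=.
  case: (ltngtP k n0) => [kn|nk|->].
  - by move: hk; rewrite !modn_small ?(ltn_trans kn) // => /eqP e'; rewrite e' ltnn in kn.
  - have [j hj] : exists j, (k = n0 + A * j)%N.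
      move: hk; rewrite eqn_mod_dvd ?(ltnW nk) // => /dvdnP[j hj].
      by exists j; rewrite mulnC -hj subnKC // ltnW.
    have j0 : (0 < j)%N by rewrite lt0n; apply: contraL nk => /eqP j0; rewrite hj j0 muln0 addn0 ltnn.
    rewrite hj; split=> [|_]; last exact: hdvd.
    by apply: dvdn_trans (hdvd j0); rewrite dvdn_exp2l // ltnW // v_lt_e.
  - by rewrite pfactor_dvdnn; split=> //; rewrite mulnC eqxx.
pose P' : fps int := Fps (fun N => (cf Psec N %/ Posz (p ^ v))%Z).
have hP' N : cf Psec N = cf P' N * Posz (p ^ v).
  by rewrite cfE divzK // dvdzE; case: (main N).
have hq N : (Posz p %| cf P' N)%Z = (p ^ v.+1 %| absz (cf Psec N))%N.
  by rewrite hP' abszM /= expnS dvdn_pmul2r ?lt0n // dvdzE.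
have hn0 : cf Psec (24 * n0) = Posz (npart n0).
  by rewrite cf_Psec dvdn_mulr // mulKn // eqxx.
exists P', (cf P' (24 * n0))%:~R; split.
- by apply: fpsP => N; rewrite -fpsC_int cf_CM hP' mulrC.
- by rewrite intr_Fp_eq0 // hq hn0 pfactor_dvdn ?npart_n0_gt0 // ltnn.
apply: fpsP => N; rewrite cf_CM cf_Xn cfE.
case: eqP => [->|/eqP hN]; first by rewrite mulr1.
rewrite mulr0; apply/eqP; rewrite intr_Fp_eq0 //.
rewrite hq; case: (main N) => _ /(_ hN); apply: dvdn_trans.
by rewrite dvdn_exp2l // v_lt_e.
Qed.

Fact dvd12_period : (12 %| 2 * mu)%N.
Proof. by rewrite -!mulnA mulnCA dvdn_mulr. Qed.

Fact hom_eta : hom mu 1 eta.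
Proof.
by apply: hom_theta core_mu_gt0 _ _ => n; apply: eta_char_period; exact: dvd12_period.
Qed.

Fact hom_eta2 : hom mu 1 eta2.
Proof.
apply: hom_theta core_mu_gt0 _ _ => n; apply: dilated_char_period; first exact: prime_gt0.
by apply/dvdnP; exists (2 * A)%N; ring.
Qed.

Fact hom_sec i j : hom mu 1 (sec_theta Q eta_char i j).
Proof.
rewrite mxE; apply: hom_theta core_mu_gt0 _ _ => n; apply: sec_char_period.
  exact: dvd12_period.
by apply/dvdnP; exists p; ring.
Qed.

Fact hom_Mdet : hom mu Q Mdet.
Proof. by apply: hom_det core_mu_gt0 _ _ _ => i j; exact: hom_sec. Qed.

Fact hom_Cof : hom mu Q.-1 Cof.
Proof.
rewrite /Cof mxE /cofactor.
have -> : (-1) ^+ (idx0 + idx1) = ((-1) ^+ (idx0 + idx1) : int)%:~R :> fps int.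
  by rewrite rmorphXn rmorphN1.
apply: homZ; apply: hom_det core_mu_gt0 _ _ _ => i j.
by have := hom_sec (lift idx0 i) (lift idx1 j); rewrite !mxE.
Qed.

Theorem isolated_partition_value : False.
Proof.
have mu0 := core_mu_gt0.
(* [D] makes the (D+1)^2 products outnumber the bound (K+1) W, which is at most D (D+1). *)
pose W := (8 ^ (2 * mu))%N; pose D := (W * (Q + 2))%N; pose K := (Q * D + D)%N.
(* The monomials in Cof eta / Mdet = Psec eta / x and in eta2 / eta, homogenised to the common
   degree [K]. *)
pose f (x : 'I_D.+1 * 'I_D.+1) : fps int :=
  (Cof * eta) ^+ x.1 * Mdet ^+ (D - x.1) * eta2 ^+ x.2 * eta ^+ (D - x.2).
have hf x : hom mu K (f x).
  have -> : K = (Q * x.1 + Q * (D - x.1) + x.2 + (D - x.2))%N.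
    have h1 := ltn_ord x.1; have h2 := ltn_ord x.2.
    by rewrite -mulnDr subnKC // -addnA subnKC.
  apply: homM => //; last by rewrite -[X in hom _ X _]mul1n; apply: homX => //; exact: hom_eta.
  apply: homM => //; last by rewrite -[X in hom _ X _]mul1n; apply: homX => //; exact: hom_eta2.
  apply: homM => //; last by apply: homX => //; exact: hom_Mdet.
  apply: homX => //.
  by have := homM hom_Cof hom_eta; rewrite addn1 prednK ?Q_gt0.
have hcard : (K.+1 * 8 ^ (2 * mu) < #|{: 'I_D.+1 * 'I_D.+1}|)%N.
  rewrite card_prod !card_ord -/W.
  have W0 : (0 < W)%N by rewrite expn_gt0.
  have h : (K.+1 <= (Q + 2) * D.+1)%N by rewrite /K; lia.
  apply: (@leq_ltn_trans ((Q + 2) * D.+1 * W)); first by rewrite leq_mul2r h orbT.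
  have -> : ((Q + 2) * D.+1 * W = D * D.+1)%N by rewrite /D; ring.
  by rewrite ltn_mul2r ltnSn.
have [d [[x0 hx0] hd]] := hom_dependent mu0 hf hcard.
have [P' [u [hP' u0 hu]]] := Psec_split.
pose g (x : 'I_D.+1 * 'I_D.+1) : fps int :=
  fpsX ^+ (D - x.1) * P' ^+ x.1 * eta ^+ x.1 * eta2 ^+ x.2 * eta ^+ (D - x.2).
pose c (x : 'I_D.+1 * 'I_D.+1) : int := d x * Posz (p ^ v) ^+ x.1.
have fg x : fpsX ^+ D * ((d x)%:~R * f x) = Mdet ^+ D * ((c x)%:~R * g x).
  have h1 : (x.1 <= D)%N by rewrite -ltnS.
  have split_exp (y : fps int) : y ^+ D = y ^+ (D - x.1) * y ^+ x.1 by rewrite -exprD subnK.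
  rewrite /f /g /c intrM rmorphXn /= exprMn (split_exp fpsX) (split_exp Mdet).
  transitivity (fpsX ^+ (D - x.1) * (fpsX * Cof) ^+ x.1 * eta ^+ x.1 * Mdet ^+ (D - x.1)
     * eta2 ^+ x.2 * eta ^+ (D - x.2) * (d x)%:~R).
    by rewrite [(fpsX * Cof) ^+ _]exprMn; ring.
  by rewrite fpsX_Cof hP' !exprMn; ring.
have hg : \sum_x (c x)%:~R * g x = 0.
  (* [Mdet] can be cancelled because it divides a power of x, by [Mdet_Pdet]. *)
  apply: (@fpsXn_inj _ (Q * D)); rewrite exprM -Mdet_Pdet exprMn mulrAC mulr_sumr.
  rewrite -(eq_bigr _ (fun x _ => fg x)) -mulr_sumr hd mulr0 mul0r //.
have c0 : exists x, c x != 0.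
  exists x0; rewrite mulf_neq0 // expf_neq0 // eqz_nat -lt0n expn_gt0 prime_gt0 //.
have [b [c' [b0 [x1 hx1] hc]]] := primitive_family pp c0.
have {}hg : \sum_x (c' x)%:~R * g x = 0.
  apply: (fps_int_cancel b0); rewrite mulr_sumr -[RHS]hg.
  by apply: eq_bigr => x _; rewrite hc intrM mulrA.
have heta : map_fps (@intmul 'F_p 1) eta = eta_mod p 1 by exact: map_theta.
have heta2 : map_fps (@intmul 'F_p 1) eta2 = eta_mod p 1 ^+ (p ^ 2).
  by rewrite theta_dilated ?prime_gt0 // eta_mod_expp //; exact: map_theta.
(* Modulo [p], [P'] is a monomial and [eta2] is eta^(p^2), so [g (i, j)] becomes u^i x^(a i) eta^(e'
   i j). These pairs of exponents are distinct, and one coefficient is prime to [p], hence [B] is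
   nonzero. *)
pose a (i : nat) := (D - i + 24 * n0 * i)%N.
pose e' (i j : nat) := (i + p ^ 2 * j + (D - j))%N.
pose q (x : 'I_D.+1 * 'I_D.+1) : 'F_p := (c' x)%:~R * u ^+ x.1.
pose B : {poly {poly 'F_p}} := \sum_x (q x *: 'X^(a x.1)) *: 'X^(e' x.1 x.2).
have B0 : B != 0.
  apply/eqP => /(congr1 (fun P : {poly {poly 'F_p}} => (P`_(e' x1.1 x1.2))`_(a x1.1))).
  rewrite coef0 coef0 /B coef_sum coef_sum (bigD1 x1) //=.
  rewrite coefZ coefXn eqxx mulr1 coefZ coefXn eqxx mulr1 big1 ?addr0 => [|x xx1].
    apply/eqP; rewrite mulf_neq0 ?expf_neq0 //.
    by rewrite intr_Fp_eq0.
  rewrite coefZ coefXn; case: eqP => he; last by rewrite mulr0 coef0.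
  rewrite mulr1 coefZ coefXn; case: eqP => ha; last by rewrite mulr0.
  case/negP: xx1; apply/eqP.
  have l1 := ltn_ord x.1; have l2 := ltn_ord x1.1.
  have e1 : x.1 = x1.1 :> nat by apply/esym; apply: shifted_exponent_inj ha; rewrite -ltnS.
  have p2 : (1 < p ^ 2)%N by rewrite -(exp1n 2) ltn_exp2r // prime_gt1.
  have l3 := ltn_ord x.2; have l4 := ltn_ord x1.2.
  have e2 : x.2 = x1.2 :> nat.
    move: he; rewrite /e' e1 -!addnA => /addnI h; apply/esym; move: h.
    by apply: scaled_exponent_inj; rewrite // -ltnS.
  by apply/eqP; rewrite -pair_eqE /= -!val_eqE /= e1 e2 !eqxx.
have := eta_transcendental pp B0; rewrite /B rmorph_sum horner_sum => /eqP; apply.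
have := congr1 (map_fps (@intmul 'F_p 1)) hg; rewrite rmorph0 rmorph_sum => h.
rewrite -[RHS]h; apply: eq_bigr => x _.
rewrite /= map_polyZ map_polyXn hornerZ hornerXn /g.
rewrite rmorphM rmorph_int !rmorphM !rmorphXn /= heta heta2 hu map_fpsX.
have -> : fps_poly (q x *: 'X^(a x.1)) = (c' x)%:~R * fpsC u ^+ x.1 * fpsX ^+ a x.1.
  rewrite -mul_polyC rmorphM rmorphXn /= /q polyCM rmorphM polyC_exp rmorphXn /=.
  by rewrite /fpsC /fpsX !rmorph_int.
rewrite /a /e' [fpsX ^+ (D - x.1 + _)]exprD [eta_mod p 1 ^+ (_ + (D - x.2))]exprD.
rewrite [eta_mod p 1 ^+ (x.1 + _)]exprD [(fpsC u * _) ^+ _]exprMn [fpsX ^+ (24 * n0 * _)]exprM [eta_mod p 1 ^+ (p ^ 2 * _)]exprM.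
move: (eta_mod p 1 ^+ x.1) (eta_mod p 1 ^+ (p ^ 2) ^+ x.2) (eta_mod p 1 ^+ (D - x.2)).
move: (fpsX ^+ (D - x.1)) (fpsX ^+ (24 * n0) ^+ x.1) (fpsC u ^+ x.1).
by move: ((c' x)%:~R : fps 'F_p) => z1 z2 z3 z4 z5 z6 z7; ring.
Qed.
End Core.

(* Backward propagation and the conclusion *)
Local Close Scope ring_scope.

Lemma npartz_progression (k a : nat) (b : int) : 0 < k ->
  (forall n : nat, k %| npartz (a%:Z * n%:Z + b)%R) ->
  forall z : int, k %| npartz (a%:Z * z + b)%R.
Proof.
move=> k0 H z; case E: (a%:Z * z + b)%R => [n0|n0]; last exact: dvdn0.
apply/(dvdn_partP _ k0) => p; rewrite mem_primes => /andP[pp _].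
rewrite p_part; apply/negPn/negP => hn.
(* If a = 0 the progression is constant and [H 0] already gives the divisibility. *)
have a0 : 0 < a.
  rewrite lt0n; apply/negP => /eqP a0; move: E (H 0); rewrite a0 !mul0r => ->.
  by move=> /(dvdn_trans (pfactor_dvdnn p k)); apply/negP.
(* Large enough that a r > n0 and that z + r j is non-negative for every j >= 1: along the modulus a
   r, n0 is then an isolated failure. *)
pose r := `|z| + n0.+1.
apply: (@isolated_partition_value p (logn p k) (a * r) n0) => //.
  by apply: (@leq_trans r); rewrite ?leq_pmull // /r addnS ltnS leq_addl.
move=> j j0; apply: (dvdn_trans (pfactor_dvdnn p k)).
have rj : (0 <= z + (r * j)%:Z)%R by have := leq_pmulr r j0; rewrite /r; lia.
have := H (absz (z + (r * j)%:Z)%R); rewrite gez0_abs //.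
have -> : (a%:Z * (z + (r * j)%:Z) + b = Posz (n0 + a * r * j))%R.
  by rewrite PoszD -E !PoszM; ring.
by [].
Qed.

Unset Implicit Arguments.

Theorem theorem3p2 (k m a : nat) (b : int) :
  (0 < k)%N -> (0 < m)%N -> (0 < a)%N ->
  (forall n : nat, (k %| npartz (a%:Z * n%:Z + b)%R)%N) ->
  forall t : nat, (0 < t)%N ->
  forall n : nat, (k %| pmexz (m * a * t) (a * t) (a%:Z * n%:Z + b)%R)%N.
Proof.
move=> k0 m0 a0 H t t0 n; case E: (a%:Z * n%:Z + b)%R => [N|N]; last exact: dvdn0.
apply: dvdn_pmex => [||i hi]; first by rewrite muln_gt0 a0.
  by rewrite -mulnA leq_pmull.
have hs : a %| sumn (mex_terms (m * a * t) (a * t) i).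
  rewrite sumnE big_map; apply: dvdn_sum => j _.
  have am : a %| m * a * t by rewrite dvdn_mulr // dvdn_mull.
  by apply: dvdn_add; apply: dvdn_mulr.
(* The shift is a multiple of [a], so it stays in the progression, possibly at a negative index;
   this is where backward propagation enters. *)
have := npartz_progression k0 H (n%:Z - (sumn (mex_terms (m * a * t) (a * t) i) %/ a)%:Z)%R.
rewrite mulrBr addrAC E -PoszM [(a * _)%N]mulnC divnK //.
by rewrite subzn.
Qed.
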